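(* For all $x\in\Omega$, all $i\in S$ and all $t>0$, $$\mathbb E_x\big(x_i(t)\big)=\sum_{j\in S}p_t(i,j)\,x_j.$$
   Context: $S$ is a (finite or countably infinite) set of vertices, and $p(i,j)$ is an irreducible symmetric random walk kernel on $S$: $p(i,j)=p(j,i)\ge0$, $\sum_jp(i,j)=1$, and for all $i,j\in S$ there is $n$ with $p^{(n)}(i,j)>0$. $(x(t))_{t\ge0}$ is the Markov process on $\Omega=[0,\infty)^S$ with generator $$Lf(x)=\sum_{i,j}p(i,j)\int_0^1\int_0^1\big(f(x^{ij;uv})-f(x)\big)\,du\,dv,$$ the sum being over ordered pairs of distinct vertices, where $x^{ij;uv}_k=x_k$ for $k\notin\{i,j\}$, $x^{ij;uv}_i=x_i(1-u)+x_jv$, $x^{ij;uv}_j=x_j(1-v)+x_iu$. $\mathbb E_x$ is expectation for this process started from $x$, and $x_i(t)$ is the $i$-th coordinate at time $t$. $p_t(i,j)$ denotes the time-$t$ transition probability of the continuous-time random walk on $S$ that jumps from $i$ to $j$ at rate $p(i,j)$. *)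

(* Defs.v *)
From HB Require Import structures.
From mathcomp Require Import all_boot all_order all_algebra.
From mathcomp Require Import all_classical all_reals all_analysis.

Set Implicit Arguments.
Unset Strict Implicit.
Unset Printing Implicit Defensive.

Import Order.TTheory GRing.Theory Num.Theory.
Import numFieldNormedType.Exports.

Local Open Scope classical_set_scope.
Local Open Scope ring_scope.

Fixpoint kernel_iter (R : realType) (S : countType) (p : S -> S -> R)
    (n : nat) (i j : S) : \bar R :=
  if n is m.+1 then (\esum_(k in [set: S]) ((p i k)%:E * kernel_iter p m k j))%E
  else ((i == j)%:R)%:E.

Record irreducible_symmetric_kernel (R : realType) (S : countType)
    (p : S -> S -> R) : Prop := IrreducibleSymmetricKernel {
  kernel_sym : forall i j, p i j = p j i ;
  kernel_ge0 : forall i j, 0 <= p i j ;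
  kernel_sum1 : forall i, (\esum_(j in [set: S]) (p i j)%:E = 1)%E ;
  kernel_irr : forall i j, exists n, (0 < kernel_iter p n i j)%E }.

(* [q t i j] is the time-[t] transition probability (for [t >= 0]) of the
   continuous-time Markov chain on [S] whose Q-matrix is [p - 1]: the rate of
   the jumps from [i] to [j != i] is [p i j], and the total rate of leaving
   [i] is [1 - p i i], the sum of the [p i j] over [j != i]. *)
Record walk_transition (R : realType) (S : countType) (p : S -> S -> R)
    (q : R -> S -> S -> R) : Prop := WalkTransition {
  walk_ge0 : forall t i j, 0 <= t -> 0 <= q t i j ;
  walk_sum1 : forall t i, 0 <= t ->
    (\esum_(j in [set: S]) (q t i j)%:E = 1)%E ;
  walk_0 : forall i j, q 0 i j = (i == j)%:R ;
  walk_chapman_kolmogorov : forall s t i j, 0 <= s -> 0 <= t ->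
    ((q (s + t) i j)%:E = \esum_(k in [set: S]) ((q s i k)%:E * (q t k j)%:E))%E ;
  walk_rate : forall i j,
    (q h i j - (i == j)%:R) / h @[h --> 0^'+] --> p i j - (i == j)%:R }.

Record config (R : realType) (S : countType) := Config {
  coord :> S -> R ;
  coord_ge0 : forall i, 0 <= coord i }.

Section config_measurable.
Variables (R : realType) (S : countType).

HB.instance Definition _ := gen_eqMixin (config R S).
HB.instance Definition _ := gen_choiceMixin (config R S).
HB.instance Definition _ := isPointed.Build (config R S)
  (@Config R S (fun=> 0) (fun=> lexx 0)).

Definition coord_preimages : set (set (config R S)) :=
  [set A | exists i : S, exists2 B : set R, measurable B &
           A = [set x : config R S | B (x i)]].

HB.instance Definition _ :=
  @isMeasurable.Build default_measure_display (config R S)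
    <<s coord_preimages >>
    (@sigma_algebra0 _ setT coord_preimages)
    (@sigma_algebraC _ coord_preimages)
    (@sigma_algebra_bigcup _ setT coord_preimages).

End config_measurable.

Definition transition_semigroup d (R : realType) (E : measurableType d)
    (P : R -> R.-pker E ~> E) : Prop :=
  (forall (x : E) (A : set E), measurable A -> P 0 x A = (\d_x A : \bar R)) /\
  (forall (s t : R) (x : E) (A : set E), 0 <= s -> 0 <= t -> measurable A ->
    P (s + t) x A = (\int[P s x]_y P t y A)%E).

(* Every [f] in [D] is in the domain of the (Hille-Yosida) generator of the
   semigroup [P_t f x = \int f(y) P_t(x, dy)] acting on bounded measurable
   functions with the sup norm, and the generator maps [f] to [L f]. *)
Definition has_generator_on d (R : realType) (E : measurableType d)
    (P : R -> R.-pker E ~> E) (D : set (E -> R)) (L : (E -> R) -> E -> R)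
    : Prop :=
  forall f, D f -> forall e : R, 0 < e -> \forall h \near 0^'+, forall x : E,
    `| (\int[P h x]_y f y - f x) / h - L f x | <= e.

Definition past d d' (R : realType) (W : measurableType d)
    (E : measurableType d') (X : R -> W -> E) (s : R) : set (set W) :=
  <<s [set A | exists2 r : R, 0 <= r <= s &
               exists2 B : set E, measurable B & A = X r @^-1` B] >>.

Record markov_process_from d d' (R : realType) (W : measurableType d)
    (Pr : probability W R) (E : measurableType d') (P : R -> R.-pker E ~> E)
    (x : E) (X : R -> W -> E) : Prop := MarkovProcessFrom {
  process_measurable : forall t, 0 <= t -> measurable_fun [set: W] (X t) ;
  process_start : {ae Pr, forall w, X 0 w = x} ;
  process_markov : forall (s t : R) (A : set W) (B : set E), 0 <= s -> 0 <= t ->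
    past X s A -> measurable B ->
    Pr (A `&` X (s + t) @^-1` B) = (\int[Pr]_(w in A) P t (X s w) B)%E }.

Section exchange.
Variables (R : realType) (S : countType).

Definition exchange_fun (x : S -> R) (i j : S) (u v : R) (k : S) : R :=
  if k == i then x i * (1 - u) + x j * v
  else if k == j then x j * (1 - v) + x i * u
  else x k.

Lemma max0_ge0 (y : S -> R) k : 0 <= Num.max 0 (y k).
Proof. by rewrite le_max lexx. Qed.

(* For [u] and [v] in [0, 1], the only values used below, [exchange_fun x i j u v]
   is nonnegative and the maximum with 0 leaves it unchanged. *)
Definition exchange (x : config R S) (i j : S) (u v : R) : config R S :=
  Config (max0_ge0 (exchange_fun x i j u v)).

(* The sum of [a] when [a] is absolutely summable; a junk value otherwise. *)
Definition abs_sum (T : choiceType) (a : T -> R) : R :=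
  fine (\esum_(k in [set: T]) (a^\+ k)%:E) -
  fine (\esum_(k in [set: T]) (a^\- k)%:E).

Definition exchange_generator (p : S -> S -> R) (f : config R S -> R)
    (x : config R S) : R :=
  abs_sum (fun ij : S * S =>
    if ij.1 == ij.2 then 0
    else p ij.1 ij.2 *
      \int[lebesgue_measure]_(v in `[0, 1]) \int[lebesgue_measure]_(u in `[0, 1])
        (f (exchange x ij.1 ij.2 u v) - f x)).

(* For these [f], and a kernel [p] as above, the sum defining
   [exchange_generator p f x] converges absolutely, uniformly in [x]: only the
   pairs meeting the finite set [A] contribute. *)
Definition bounded_local : set (config R S -> R) :=
  [set f : config R S -> R | [/\ measurable_fun [set: config R S] f,
    (exists M : R, forall x, `|f x| <= M) &
    exists A : seq S, forall x y : config R S,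
      (forall i, i \in A -> x i = y i) -> f x = f y]].

End exchange.

(* Main.v *)
Require Import Defs.
From HB Require Import structures.
From mathcomp Require Import all_boot all_order all_algebra.
From mathcomp Require Import all_classical all_reals all_analysis.
From mathcomp Require Import measurable_realfun ring lra.

Set Implicit Arguments.
Unset Strict Implicit.
Unset Printing Implicit Defensive.

Import Order.TTheory GRing.Theory Num.Theory.
Import numFieldNormedType.Exports.

Local Open Scope classical_set_scope.
Local Open Scope ring_scope.

(** Write [h_N(y) = min(y, N)], [x_k] for the [k]-th coordinate of a
configuration and [(J a)_i = \sum_j p_ij (a_i + a_j)].  A single exchange
averages: concavity and subadditivity of [h_N] give
  [J (h_{N/2}(x_.))_k <= (L h_N(x_k) + 2 h_N(x_k)) <= J (h_{2N}(x_.))_k].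
Hence the bounded functions [e^{2t} E_x h_{2^m C}(x_k(t))] satisfy, up to a shift
of the level [m], the two halves of the linear equation [u' = J u], and
iterating the one-sided inequalities squeezes [e^{2t} E_x x_i(t)] between the
partial sums of [\sum_n t^n/n! (J^n x)_i] (the error of the upper bound is
[O((4t)^n/n!)]).  Only polynomials in [t] with nonnegative coefficients appear,
so nothing has to be assumed on the growth of [x], and both sides may be
infinite.  The transition probabilities [q t i j] of the walk solve
[u' = J u - 2 u] exactly, so the same comparison identifies
[\sum_n t^n/n! (J^n x)_i] with [e^{2t} \sum_j q t i j x_j]. *)

(** * Right derivatives *)

(** Uniformity in [s] gives left continuity as well: for [r < s] the increment from [r] to [s] is a
    right increment based at [r]. *)
Lemma continuous_within_right_unif (R : realType) (f : R -> R) (T : R) :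
  (forall e : R, 0 < e -> \forall h \near 0^'+, forall s : R, 0 <= s ->
    `|f (s + h) - f s| <= e) ->
  {within `[0, T], continuous f}.
Proof.
(* Composing with [Num.max 0] extends [f] to the left by the constant [f 0], so that continuity can
   be proved on the whole line. *)
move=> fu; apply: (@subspace_eq_continuous _ _ _ (f \o Num.max 0)).
  by move=> s /set_mem/=; rewrite in_itv/= => /andP[s0 _]; rewrite max_r.
apply: continuous_subspaceT => s.
apply/cvgrPdist_le => e e0; have [d /= d0 fd] := fu e e0.
have {}fd a b : 0 <= a -> a <= b -> b - a < d -> `|f b - f a| <= e.
  move=> a0; rewrite le_eqVlt => /orP[/eqP-> _|ab bad].
    by rewrite subrr normr0 ltW.
  have := fd (b - a); rewrite /ball/= sub0r normrN gtr0_norm ?subr_gt0//.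
  by move=> /(_ bad ab a a0); rewrite addrCA subrr addr0.
exists d => //= r; rewrite /ball/= => srd.
have H a b : a <= b -> b - a < d -> `|f (Num.max 0 b) - f (Num.max 0 a)| <= e.
  move=> ab bad; apply: fd; rewrite ?le_max ?lexx//.
    by case: (leP 0 a); case: (leP 0 b); lra.
  by case: (leP 0 a); case: (leP 0 b); lra.
case: (leP s r) srd => [sr|/ltW rs] srd; first rewrite distrC.
  by apply: H => //; move: srd; rewrite ler0_norm; lra.
by apply: H => //; move: srd; rewrite ger0_norm; lra.
Qed.

(** Suppose [f T < f 0] and let [e] be half the mean rate of decrease. Then [f s + e * s] is smaller
    at [T] than at 0, so its maximum is attained at some [c < T]. Just to the right of [c], [f]
    loses at most [e / 2 * h], so the function exceeds its maximum. *)
Lemma le_right_deriv_ge0 (R : realType) (f : R -> R) (T : R) : 0 <= T ->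
  {within `[0, T], continuous f} ->
  (forall s : R, 0 <= s < T -> forall e : R, 0 < e ->
    \forall h \near 0^'+, f s - e * h <= f (s + h)) ->
  f 0 <= f T.
Proof.
rewrite le_eqVlt => /predU1P[<-//|T0] fc fd.
rewrite leNgt; apply/negP => fT.
pose e := (f 0 - f T) / (2 * T).
have e0 : 0 < e by rewrite divr_gt0 ?subr_gt0// mulr_gt0.
have gc : {within `[0, T], continuous (fun s => f s + e * s)}.
  move=> s; apply: cvgD; first exact: fc.
  by apply: continuous_subspaceT => r; apply: mulrl_continuous.
have [c /[!in_itv]/=/andP[c0 cT] cmax] := EVT_max (ltW T0) gc.
have eT : e * T = (f 0 - f T) / 2 by rewrite /e; field; lra.
have {}cT : c < T.
  rewrite lt_neqAle cT andbT; apply/eqP => cT'.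
  have := cmax 0; rewrite in_itv/= lexx ltW// cT' eT mulr0 => /(_ isT).
  by move=> ?; lra.
have e20 : 0 < e / 2 by rewrite divr_gt0.
suff : \forall h \near (0 : R)^'+, False by move=> /filter_ex[].
near=> h.
have h0 : 0 < h by near: h; exact: nbhs_right_gt.
have hT : h < T - c by near: h; apply: nbhs_right_lt; rewrite subr_gt0.
have : f c - e / 2 * h <= f (c + h).
  by near: h; apply: fd => //; rewrite c0.
have := cmax (c + h); rewrite in_itv/= => /(_ _).
have -> : 0 <= c + h <= T by apply/andP; split; lra.
have : 0 < e * h by rewrite mulr_gt0.
by rewrite mulrDr => ? /(_ isT); lra.
Unshelve. all: by end_near. Qed.

Lemma cvg_right_diff_quot (R : realType) (f : R -> R) (s df : R) :
  is_derive s 1 f df -> (f (s + h) - f s) / h @[h --> 0^'+] --> df.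
Proof.
move=> fs; have := @ex_derive _ _ _ _ _ _ _ fs.
rewrite /derivable => /cvg_ex[l fl].
have -> : df = l by rewrite -(@derive_val _ _ _ _ _ _ _ fs); apply/cvg_lim.
apply: cvg_dnbhs_at_right; apply: cvg_trans fl.
apply: near_eq_cvg; near=> h.
by rewrite /= /GRing.scale/= mulr1 mulrC (addrC s).
Unshelve. all: by end_near. Qed.

Lemma horner_le_expR_mul (R : realType) (f df : R -> R) (G : {poly R}) (T : R) :
  0 <= T ->
  (forall e : R, 0 < e -> \forall h \near 0^'+, forall s : R, 0 <= s ->
    `|f (s + h) - f s| <= e) ->
  (forall s : R, 0 <= s -> (f (s + h) - f s) / h @[h --> 0^'+] --> df s) ->
  G.[0] <= f 0 ->
  (forall s : R, 0 <= s < T -> G^`().[s] <= expR (2 * s) * (df s + 2 * f s)) ->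
  G.[T] <= expR (2 * T) * f T.
Proof.
move=> T0 fu fd G0 dG.
pose g s := expR (2 * s) * f s - G.[s].
suff : g 0 <= g T.
  by rewrite /g mulr0 expR0 mul1r; lra.
apply: le_right_deriv_ge0 => //.
  have := @continuous_within_right_unif R f T fu.
  move=> fc s; apply: cvgB; last first.
    by apply: continuous_subspaceT => r; exact: continuous_horner.
  apply: cvgM; last exact: fc.
  apply: continuous_subspaceT => r; apply: continuous_comp.
    exact: mulrl_continuous.
  exact: continuous_expR.
move=> s /[dup] sT /andP[s0 _] e e0.
have gd : (g (s + h) - g s) / h @[h --> 0^'+] -->
    expR (2 * s) * df s + expR (2 * s) * 2 * f s - G^`().[s].
  have ed : is_derive s 1 (fun r => expR (2 * r)) (expR (2 * s) * 2).
    apply: (@is_derive1_comp _ expR (fun r => 2 * r)).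
    have := is_deriveZ 2 (is_derive_id s (1 : R)); rewrite /GRing.scale/= mulr1.
    by apply.
  have Gd := cvg_right_diff_quot (is_derive_poly G s).
  have {}ed := cvg_right_diff_quot ed.
  have ec : expR (2 * (s + h)) @[h --> 0^'+] --> expR (2 * s).
    have : continuous (fun r => expR (2 * (s + r)) : R).
      move=> r; apply: continuous_comp; last exact: continuous_expR.
      apply: cvgM; first exact: cvg_cst.
      by apply: cvgD; [exact: cvg_cst|exact: cvg_id].
    move=> /(_ 0)/cvg_at_right_filter; rewrite addr0; exact.
  have fs : f s @[h --> (0 : R)^'+] --> f s by exact: cvg_cst.
  have := cvgB (cvgD (cvgM ec (fd s s0)) (cvgM ed fs)) Gd.
  move=> /(_ _ _ _ _); apply: cvg_trans; apply: near_eq_cvg; near=> h.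
  have h0 : 0 < h by near: h; exact: nbhs_right_gt.
  rewrite /g !fctE/=; field. lra.
have /cvgrPdist_le/(_ _ e0) := gd.
apply: filter_app; near=> h.
have h0 : 0 < h by near: h; exact: nbhs_right_gt.
rewrite ler_distlC => /andP[+ _].
rewrite ler_pdivlMr// => gh.
have := dG s sT.
have : 0 <= h * (expR (2 * s) * df s + expR (2 * s) * 2 * f s - G^`().[s]).
  by rewrite mulr_ge0 ?(ltW h0)//; have := dG s sT; lra.
move: gh; nra.
Unshelve. all: by end_near. Qed.
(** * The operator J and its exponential series *)

(** Finite partial sums give one inequality; the other is the same inequality for the factor [c^-1].
    The case [c = 0] is separate and rests on [0 * +oo = 0]. *)
Lemma esumZl (R : realType) (T : choiceType) (c : R) (a : T -> \bar R) :
  0 <= c -> (forall i, 0 <= a i)%E ->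
  (\esum_(i in [set: T]) (c%:E * a i) = c%:E * \esum_(i in [set: T]) a i)%E.
Proof.
have le (r : R) (b : T -> \bar R) : 0 <= r -> (forall i, 0 <= b i)%E ->
    (\esum_(i in [set: T]) (r%:E * b i) <= r%:E * \esum_(i in [set: T]) b i)%E.
  move=> r0 b0; apply: ge_ereal_sup => _ [A [finA _] <-].
  rewrite fsbig_finite//= -ge0_sume_distrr; last by move=> *; exact: b0.
  rewrite lee_wpmul2l ?lee_fin// -fsbig_finite//.
  by apply: ereal_sup_ubound; exists A.
rewrite le_eqVlt => /predU1P[<- a0|c0 a0].
  by rewrite mul0e esum1// => i _; rewrite mul0e.
apply/eqP; rewrite eq_le; apply/andP; split; first by apply: le => //; exact: ltW.
rewrite -lee_pdivlMl//.
have -> : (\esum_(i in [set: T]) a i =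
    \esum_(i in [set: T]) ((c^-1)%:E * (c%:E * a i)))%E.
  by apply: eq_esum => i _; rewrite muleA -EFinM mulVf ?mul1e// gt_eqF.
apply: le => [|i]; first by rewrite invr_ge0 ltW.
by rewrite mule_ge0// lee_fin ltW.
Qed.

Section lazy_iteration.
Context {R : realType} {S : countType}.
Variable p : S -> S -> R.
Hypothesis p0 : forall i j, 0 <= p i j.
Hypothesis p1 : forall i, (\esum_(j in [set: S]) (p i j)%:E = 1)%E.
Implicit Types a b : S -> \bar R.

Local Open Scope ereal_scope.

(* [p - 1] shifted by [2], the total rate of the exchanges involving a given site. *)
Definition lazy_op a i : \bar R := \esum_(j in [set: S]) ((p i j)%:E * (a i + a j)).

Let p0E i j : 0 <= (p i j)%:E. Proof. by rewrite lee_fin. Qed.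

Lemma lazy_op_ge0 a i : (forall j, 0 <= a j) -> 0 <= lazy_op a i.
Proof. by move=> a0; apply: esum_ge0 => j _; rewrite mule_ge0 ?adde_ge0. Qed.

Lemma iter_lazy_op_ge0 n a i : (forall j, 0 <= a j) -> 0 <= iter n lazy_op a i.
Proof. by move=> a0; elim: n i => //= n IHn i; exact: lazy_op_ge0. Qed.

Lemma le_lazy_op a b i : (forall j, a j <= b j) -> lazy_op a i <= lazy_op b i.
Proof. by move=> ab; apply: le_esum => j _; rewrite lee_wpmul2l ?leeD. Qed.

Lemma lazy_op_cst (c : R) i : (0 <= c)%R -> lazy_op (fun=> c%:E) i = (2 * c)%:E.
Proof.
move=> c0; rewrite /lazy_op.
under eq_esum do rewrite -EFinD muleC.
rewrite esumZl ?addr_ge0// p1 mule1; congr (_%:E); ring.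
Qed.

Lemma lazy_op_sum n (c : 'I_n -> R) (b : 'I_n -> S -> \bar R) i :
  (forall k, 0 <= c k)%R -> (forall k j, 0 <= b k j) ->
  lazy_op (fun j => \sum_(k < n) (c k)%:E * b k j) i =
  \sum_(k < n) (c k)%:E * lazy_op (b k) i.
Proof.
move=> c0 b0; rewrite /lazy_op.
have cb0 k j : 0 <= (c k)%:E * b k j by rewrite mule_ge0 ?lee_fin.
transitivity (\esum_(j in [set: S]) \sum_(k < n)
    ((c k)%:E * ((p i j)%:E * (b k i + b k j)))).
  apply: eq_esum => j _; rewrite -big_split/= ge0_sume_distrr.
    by apply: eq_bigr => k _; rewrite -ge0_muleDr// muleCA.
  by move=> k _; rewrite adde_ge0.
rewrite esum_sum; last first.
  by move=> j k _ _; rewrite !mule_ge0 ?lee_fin ?adde_ge0.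
by apply: eq_bigr => k _; rewrite esumZl// => j; rewrite mule_ge0 ?adde_ge0.
Qed.

Lemma lazy_opZ (c : R) a i : (0 <= c)%R -> (forall j, 0 <= a j) ->
  lazy_op (fun j => c%:E * a j) i = c%:E * lazy_op a i.
Proof.
move=> c0 a0; rewrite /lazy_op -esumZl// => [|j]; last by rewrite mule_ge0 ?adde_ge0.
by apply: eq_esum => j _; rewrite -ge0_muleDr// muleCA.
Qed.

Lemma lazy_opD a b i : (forall j, 0 <= a j) -> (forall j, 0 <= b j) ->
  lazy_op (fun j => a j + b j) i = lazy_op a i + lazy_op b i.
Proof.
move=> a0 b0; rewrite /lazy_op -esumD => [|j _|j _]; last 2 first.
- by rewrite mule_ge0 ?adde_ge0.
- by rewrite mule_ge0 ?adde_ge0.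
apply: eq_esum => j _; rewrite -ge0_muleDr ?adde_ge0//; congr (_ * _).
by rewrite addeACA.
Qed.

Lemma iter_lazy_op_le n a (C : R) i : (forall j, 0 <= a j) ->
  (forall j, a j <= C%:E) -> iter n lazy_op a i <= (2 ^+ n * C)%:E.
Proof.
move=> a0 aC; have C0 : (0 <= C)%R.
  by have := le_trans (a0 i) (aC i); rewrite lee_fin.
elim: n i => [|n IHn] i /=; first by rewrite expr0 mul1r.
apply: (le_trans (le_lazy_op _ IHn)).
by rewrite lazy_op_cst ?mulr_ge0 ?exprn_ge0// mulrA -exprS.
Qed.

Definition lazy_exp_sum a k (s : R) i : \bar R :=
  \sum_(n < k) (s ^+ n / n`!%:R)%:E * iter n lazy_op a i.

Let coef_ge0 (s : R) n : (0 <= s)%R -> (0 <= s ^+ n / n`!%:R)%R.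
Proof. by move=> s0; rewrite divr_ge0 ?exprn_ge0. Qed.

Lemma lazy_exp_sum_ge0 a k s i : (0 <= s)%R -> (forall j, 0 <= a j) ->
  0 <= lazy_exp_sum a k s i.
Proof.
move=> s0 a0; apply: sume_ge0 => n _.
by rewrite mule_ge0 ?iter_lazy_op_ge0// lee_fin coef_ge0.
Qed.

(** The right-hand side is the formal derivative in [s] of the partial sum with [k.+1] terms: the
    truncated exponential solves [u' = J u] up to a shift of [k]. *)
Lemma lazy_op_exp_sum a k s i : (0 <= s)%R -> (forall j, 0 <= a j) ->
  lazy_op (lazy_exp_sum a k s) i =
  \sum_(n < k) (s ^+ n / n`!%:R)%:E * iter n.+1 lazy_op a i.
Proof.
move=> s0 a0; rewrite /lazy_exp_sum lazy_op_sum// => [n|n j].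
  exact: coef_ge0.
exact: iter_lazy_op_ge0.
Qed.

Lemma lazy_exp_sum0 a k i : (forall j, 0 <= a j) -> lazy_exp_sum a k.+1 0 i = a i.
Proof.
move=> a0; rewrite /lazy_exp_sum big_ord_recl/= expr0 fact0 divr1 mul1e big1 ?adde0//.
by move=> n _; rewrite exprS mul0r mul0r mul0e.
Qed.

End lazy_iteration.

(** * Real Taylor polynomials, carrying the partial sums at a fixed site *)

Section taylor_polynomial.
Context {R : realType}.

Definition taylor_poly (b : nat -> R) k : {poly R} := \poly_(n < k) (b n / n`!%:R).

Lemma horner_taylor_poly b k s :
  (taylor_poly b k).[s] = \sum_(n < k) s ^+ n / n`!%:R * b n.
Proof. by rewrite horner_poly; apply: eq_bigr => n _; ring. Qed.

Lemma deriv_taylor_poly b k :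
  (taylor_poly b k.+1)^`() = taylor_poly (fun n => b n.+1) k.
Proof.
apply/polyP => n; rewrite coef_deriv !coef_poly ltnS; case: ifP => _; last by rewrite mul0rn.
rewrite factS natrM invfM -mulr_natr; field.
by rewrite nat1r !pnatr_eq0 -!lt0n fact_gt0.
Qed.

End taylor_polynomial.

(** * One-sided differential inequalities against the exponential series *)

Section lazy_comparison.
Context {R : realType} {S : countType}.
Variable p : S -> S -> R.
Hypothesis p0 : forall i j, 0 <= p i j.
Hypothesis p1 : forall i, (\esum_(j in [set: S]) (p i j)%:E = 1)%E.
Variables f df : nat -> R -> S -> R.
Hypothesis f_ge0 : forall m (s : R) i, 0 <= s -> 0 <= f m s i.
Hypothesis f_unif : forall m i (e : R), 0 < e ->
  \forall h \near 0^'+, forall s : R, 0 <= s -> `|f m (s + h) i - f m s i| <= e.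
Hypothesis f_deriv : forall m i (s : R), 0 <= s ->
  (f m (s + h) i - f m s i) / h @[h --> 0^'+] --> df m s i.
Variable a : S -> \bar R.
Hypothesis a0 : forall i, (0 <= a i)%E.

Let lazy_opZE c m s i : 0 <= c -> 0 <= s ->
  lazy_op p (fun j => (c * f m s j)%:E) i = (c%:E * lazy_op p (fun j => (f m s j)%:E) i)%E.
Proof.
move=> c0 s0; rewrite -lazy_opZ// => j; by rewrite lee_fin f_ge0.
Qed.

(** Induction on [k]: the derivative of the sum with [k.+1] terms is [lazy_op] of the sum with [k]
    terms, which the induction hypothesis bounds through level [k], and [lazy_op] of level [k] is
    controlled by level [k.+1]. The bound [C] keeps the iterates finite, so that they are real
    Taylor coefficients. *)
Lemma lazy_exp_sum_le (C : R) :
  (forall i, (a i <= C%:E)%E) ->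
  (forall m i, (a i <= (f m 0 i)%:E)%E) ->
  (forall m (s : R) i, 0 <= s ->
    (lazy_op p (fun j => (f m s j)%:E) i <= (df m.+1 s i + 2 * f m.+1 s i)%:E)%E) ->
  forall k t i, 0 <= t -> (lazy_exp_sum p a k t i <= (expR (2 * t) * f k t i)%:E)%E.
Proof.
move=> aC af fdf; elim=> [|k IHk] t i t0.
  by rewrite /lazy_exp_sum big_ord0 lee_fin mulr_ge0 ?expR_ge0 ?f_ge0.
pose b n := fine (iter n (lazy_op p) a i).
have bE n : (b n)%:E = iter n (lazy_op p) a i.
  rewrite fineK// ge0_fin_numE ?iter_lazy_op_ge0//.
  by rewrite (le_lt_trans (iter_lazy_op_le p0 p1 n i a0 aC))// ltry.
have tE n s : (taylor_poly b n).[s]%:E = lazy_exp_sum p a n s i.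
  rewrite horner_taylor_poly -sumEFin; apply: eq_bigr => m _.
  by rewrite EFinM bE.
have dE n (s : R) : 0 <= s ->
    ((taylor_poly b n.+1)^`()).[s]%:E = lazy_op p (lazy_exp_sum p a n s) i.
  move=> s0; rewrite deriv_taylor_poly horner_taylor_poly -sumEFin lazy_op_exp_sum//.
  by apply: eq_bigr => m _; rewrite EFinM bE.
rewrite -tE lee_fin; apply: (@horner_le_expR_mul _ (f k.+1 ^~ i) (df k.+1 ^~ i)) => //.
- by move=> e e0; exact: f_unif.
- by move=> s s0; exact: f_deriv.
- by rewrite -lee_fin tE lazy_exp_sum0.
- move=> s /andP[s0 _]; rewrite -lee_fin dE//.
  apply: (le_trans (le_lazy_op p0 i (fun j => IHk s j s0))).
  by rewrite lazy_opZE ?expR_ge0// EFinM lee_wpmul2l ?lee_fin ?expR_ge0// fdf.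
Qed.

(* The error is the [n]-th Taylor term of the constant bound [2 ^ (m + n) * D] on
   [expR (2 * s) * f (m + n) s], as [lazy_op] doubles constants. *)
Lemma lazy_exp_sum_ge (B T : R) :
  (forall m (s : R) i, 0 <= s -> f m s i <= 2 ^+ m * B) ->
  (forall m i, ((f m 0 i)%:E <= a i)%E) ->
  (forall m (s : R) i, 0 <= s ->
    ((df m s i + 2 * f m s i)%:E <= lazy_op p (fun j => (f m.+1 s j)%:E) i)%E) ->
  forall n m t i, 0 <= t <= T -> ((expR (2 * t) * f m t i)%:E <=
    lazy_exp_sum p a n t i +
    (t ^+ n / n`!%:R * (2 ^+ (m + n.*2) * (expR (2 * T) * B)))%:E)%E.
Proof.
move=> fB fa fdf; set D := expR (2 * T) * B.
have B0 : forall i : S, 0 <= B.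
  by move=> i; have := le_trans (f_ge0 0 i (lexx 0)) (fB 0 0 i (lexx 0)); rewrite expr0 mul1r.
elim=> [|n IHn] m t i /andP[t0 tT].
  rewrite /lazy_exp_sum big_ord0 add0e lee_fin expr0 fact0 divr1 mul1r addn0 /D.
  rewrite mulrCA ler_pM ?expR_ge0 ?f_ge0//; last exact: fB.
  by rewrite ler_expR ler_pM2l.
have D0 : 0 <= D by rewrite mulr_ge0 ?expR_ge0 ?(B0 i).
move: t0; rewrite le_eqVlt => /predU1P[<-|t0].
  rewrite lazy_exp_sum0// mulr0 expR0 mul1r exprS !mul0r adde0.
  exact: fa.
(* Since now [t > 0], an infinite iterate enters with a positive coefficient and makes the
   right-hand side infinite. Otherwise all coefficients are real. *)
have [fin|] := pselect (forall k : 'I_n.+1, iter k (lazy_op p) a i \is a fin_num); last first.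
  move=> /existsNP[k /negP]; rewrite ge0_fin_numE ?iter_lazy_op_ge0// -leNgt leye_eq => /eqP kE.
  rewrite (_ : lazy_exp_sum _ _ _ _ _ = +oo%E) ?addye ?leey//.
  rewrite /lazy_exp_sum (bigD1 k)//= kE gt0_muley ?lte_fin ?divr_gt0 ?exprn_gt0 ?ltr0n ?fact_gt0//.
  rewrite addye// gt_eqF// (lt_le_trans ltNy0)// sume_ge0// => j _.
  by rewrite mule_ge0 ?iter_lazy_op_ge0// lee_fin divr_ge0 ?exprn_ge0// ltW.
(* The error term is stored as the coefficient of order [n.+1]. Its derivative is [lazy_op] of the
   error at level [m.+1] and order [n]: one factor 2 comes from the level, the other from
   [lazy_op]. *)
pose b k := if k == n.+1 then 2 ^+ (m + n.+1.*2) * D else fine (iter k (lazy_op p) a i).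
have bE k : (k < n.+1)%N -> (b k)%:E = iter k (lazy_op p) a i.
  by move=> kn; rewrite /b ltn_eqF// fineK// (fin (Ordinal kn)).
have tE s : (taylor_poly b n.+2).[s]%:E =
    (lazy_exp_sum p a n.+1 s i + (s ^+ n.+1 / n.+1`!%:R * (2 ^+ (m + n.+1.*2) * D))%:E)%E.
  rewrite horner_taylor_poly -sumEFin big_ord_recr/= /b eqxx; congr (_ + _)%E.
  by apply: eq_bigr => k _; rewrite EFinM bE.
have dE (s : R) : 0 <= s -> ((taylor_poly b n.+2)^`()).[s]%:E =
    (lazy_op p (fun j => lazy_exp_sum p a n s j +
      (s ^+ n / n`!%:R * (2 ^+ (m.+1 + n.*2) * D))%:E) i)%E.
  move=> s0; have c0 : 0 <= s ^+ n / n`!%:R * (2 ^+ (m.+1 + n.*2) * D).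
    by rewrite mulr_ge0 ?divr_ge0 ?exprn_ge0// mulr_ge0 ?exprn_ge0.
  rewrite lazy_opD// => [|j]; last exact: lazy_exp_sum_ge0.
  rewrite lazy_op_cst// lazy_op_exp_sum//.
  rewrite deriv_taylor_poly horner_taylor_poly -sumEFin big_ord_recr/= {2}/b eqxx; congr (_ + _)%E.
    by apply: eq_bigr => k _; rewrite EFinM bE// ltnS ltn_ord.
  by congr (_%:E); rewrite doubleS !addnS !addSn !exprS; ring.
rewrite -tE lee_fin -lerN2 -hornerN -mulrN.
(* An upper bound on [f] is a lower bound on [- f], with the polynomial negated too. *)
apply: (@horner_le_expR_mul _ (fun s => - f m s i) (fun s => - df m s i)) => //.
- exact: ltW.
- move=> e e0; have := f_unif m i e0; apply: filterS => h H s s0.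
  by rewrite -opprD normrN H.
- move=> s s0; have := cvgN (@f_deriv m i s s0).
  move=> /(_ _); apply: cvg_trans; apply: near_eq_cvg; near=> h.
  by rewrite fctE -mulNr opprD.
- rewrite hornerN lerN2 -lee_fin tE lazy_exp_sum0// exprS !mul0r adde0; exact: fa.
- move=> s /andP[s0 sT]; rewrite derivN hornerN mulrN -opprD mulrN lerN2.
  rewrite -lee_fin dE//.
  have sT' : 0 <= s <= T by rewrite s0/= (le_trans (ltW sT)).
  apply: le_trans (le_lazy_op p0 i (fun j => IHn m.+1 s j sT')).
  by rewrite lazy_opZE ?expR_ge0// EFinM lee_wpmul2l ?lee_fin ?expR_ge0// fdf.
Unshelve. all: by end_near. Qed.

(** With [T = t] the error in [lazy_exp_sum_ge] equals [D * ((4 * t) ^+ n / n!)], where [D] does not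
    depend on [n]; it tends to 0 as the general term of an exponential series. *)
Lemma lazy_exp_series_ge (B : R) :
  (forall m (s : R) i, 0 <= s -> f m s i <= 2 ^+ m * B) ->
  (forall m i, ((f m 0 i)%:E <= a i)%E) ->
  (forall m (s : R) i, 0 <= s ->
    ((df m s i + 2 * f m s i)%:E <= lazy_op p (fun j => (f m.+1 s j)%:E) i)%E) ->
  forall m t i, 0 <= t -> ((expR (2 * t) * f m t i)%:E <=
    \sum_(n <oo) ((t ^+ n / n`!%:R)%:E * iter n (lazy_op p) a i))%E.
Proof.
move=> fB fa fdf m t i t0.
apply/lee_addgt0Pr => e e0.
pose D := 2 ^+ m * (expR (2 * t) * B).
have : D * ((4 * t) ^+ n / n`!%:R) @[n --> \oo] --> D * 0.
  apply: cvgM; first exact: cvg_cst.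
  have := cvg_series_cvg_0 (@is_cvg_series_exp_coeff R (4 * t)).
  exact.
rewrite mulr0 => /cvgrPdist_le/(_ _ e0)[N _ /(_ N (leqnn N))].
rewrite sub0r normrN => ND.
have := @lazy_exp_sum_ge B t fB fa fdf N m t i; rewrite t0 lexx => /(_ isT).
move=> /le_trans; apply; apply: leeD; last first.
  rewrite lee_fin (le_trans _ (le_trans (ler_norm _) ND))//.
  rewrite le_eqVlt; apply/orP; left; apply/eqP.
  rewrite exprD exprMn /D -muln2 mulnC exprM.
  by rewrite (_ : 2 ^+ 2 = 4); [ring|rewrite -natrX].
rewrite /lazy_exp_sum -(big_mkord xpredT
  (fun n => ((t ^+ n / n`!%:R)%:E * iter n (lazy_op p) a i)%E)).
apply: nneseries_lim_ge => n _ _.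
by rewrite mule_ge0 ?iter_lazy_op_ge0// lee_fin divr_ge0 ?exprn_ge0.
Qed.

Lemma lazy_exp_series_le (M : \bar R) t i : 0 <= t ->
  (forall k, (lazy_exp_sum p a k t i <= M)%E) ->
  (\sum_(n <oo) ((t ^+ n / n`!%:R)%:E * iter n (lazy_op p) a i) <= M)%E.
Proof.
move=> t0 kM; apply: lime_le.
  apply: is_cvg_nneseries => n _ _.
  by rewrite mule_ge0 ?iter_lazy_op_ge0// lee_fin divr_ge0 ?exprn_ge0.
by near=> k; rewrite big_mkord; exact: kM.
Unshelve. all: by end_near. Qed.

End lazy_comparison.
(** * The transition probabilities of the walk *)

Lemma exchange_esum (R : realType) (T T' : choiceType) (F : T -> T' -> \bar R) :
  (forall i j, 0 <= F i j)%E ->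
  (\esum_(i in [set: T]) \esum_(j in [set: T']) F i j =
   \esum_(j in [set: T']) \esum_(i in [set: T]) F i j)%E.
Proof.
move=> F0; rewrite !esum_esum//.
rewrite (@reindex_esum R (T' * T)%type _ ([set: T'] `*`` (fun=> [set: T])) _
  (fun z => (z.2, z.1)))//.
split => //; first by move=> [? ?] [? ?] _ _ [-> ->].
by move=> [i j] _; exists (j, i).
Qed.

Lemma le_sum_esum (R : realType) (T : choiceType) (K : seq T) (F : T -> \bar R) :
  uniq K -> (\sum_(k <- K) F k <= \esum_(k in [set: T]) F k)%E.
Proof.
move=> uK; apply: ereal_sup_ubound; exists [set` K] => //.
by rewrite -fsbig_seq.
Qed.

(** Having [t] in [K] makes [K] nonempty and lets a Kronecker delta at [t] be summed over [K]
    without loss. *)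
Lemma esum_sum_near (R : realType) (T : choiceType) (F : T -> \bar R) (t : T) (e : R) :
  0 < e -> (forall k, 0 <= F k)%E -> (\esum_(k in [set: T]) F k \is a fin_num)%E ->
  exists K : seq T, [/\ uniq K, t \in K &
    (\esum_(k in [set: T]) F k <= \sum_(k <- K) F k + e%:E)%E].
Proof.
move=> e0 F0 Ffin.
have [_ [A [finA _] <-] AF] := ub_ereal_sup_adherent e0 Ffin.
have [K AK] := (finite_seqP A).1 finA.
exists (undup (t :: K)); split; rewrite ?undup_uniq ?mem_undup ?mem_head//.
rewrite -leeBlDr//; apply: le_trans (ltW AF) _.
rewrite [leRHS]fsbig_seq ?undup_uniq//; apply: lee_fsum_nneg_subset => // x.
rewrite AK => /set_mem/= xK; apply: mem_set.
by have : x \in undup (t :: K) by rewrite mem_undup in_cons xK orbT.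
Qed.

Lemma near_seq_forall (T : Type) (I : eqType) (F : set_system T) (P : I -> T -> Prop)
    (K : seq I) : Filter F ->
  (forall k, \forall h \near F, P k h) -> \forall h \near F, forall k, k \in K -> P k h.
Proof.
move=> FF FP; elim: K => [|k K IHK]; first by near=> h.
near=> h => l; rewrite inE => /predU1P[->|]; first by near: h; exact: FP.
by move: l; near: h.
Unshelve. all: by end_near. Qed.

(** * Averages of bounded functions against probability weights *)

Section mean.
Context {R : realType} {S : countType}.
Implicit Types m v : S -> R.

Definition mean m v : R := fine (\esum_(k in [set: S]) (m k * v k)%:E)%E.

Lemma meanE m v (C : R) : (forall k, 0 <= m k) -> (forall k, 0 <= v k <= C) ->
  (\esum_(k in [set: S]) (m k)%:E = 1)%E ->
  (mean m v)%:E = (\esum_(k in [set: S]) (m k * v k)%:E)%E.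
Proof.
move=> m0 vC m1; rewrite fineK// ge0_fin_numE; last first.
  by apply: esum_ge0 => k _; have /andP[v0 _] := vC k; rewrite lee_fin mulr_ge0.
apply: (@le_lt_trans _ _ (\esum_(k in [set: S]) (`|C|%:E * (m k)%:E))%E).
  apply: le_esum => k _; have /andP[v0 vCk] := vC k.
  by rewrite lee_fin mulrC ler_wpM2r// (le_trans vCk) ?ler_norm.
by rewrite esumZl ?m1 ?mule1 ?ltry.
Qed.

Lemma le_sum_mean m v (C : R) (K : seq S) :
  (forall k, 0 <= m k) -> (forall k, 0 <= v k <= C) ->
  (\esum_(k in [set: S]) (m k)%:E = 1)%E ->
  uniq K -> \sum_(k <- K) m k * v k <= mean m v.
Proof.
by move=> m0 vC m1 uK; rewrite -lee_fin -sumEFin (meanE m0 vC m1) le_sum_esum.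
Qed.

(** Converts lower bounds valid for every [[0, 1]]-valued function into upper bounds. *)
Lemma mean_compl m v :
  (forall k, 0 <= m k) -> (forall k, 0 <= v k <= 1) ->
  (\esum_(k in [set: S]) (m k)%:E = 1)%E ->
  mean m (fun k => 1 - v k) = 1 - mean m v.
Proof.
move=> m0 v1 m1; apply/eqP; rewrite eq_sym subr_eq -[_ == _]/(_ == _ :> R).
rewrite -eqe EFinD (meanE m0 v1 m1) (@meanE _ _ 1)//; last first.
  by move=> k; have := v1 k; lra.
rewrite -esumD => [|k _|k _]; last 2 first.
- by rewrite lee_fin mulr_ge0//; have := v1 k; lra.
- by rewrite lee_fin mulr_ge0//; have := v1 k; lra.
by rewrite -m1; apply/eqP; apply: eq_esum => k _; rewrite -EFinD -mulrDr subrK mulr1.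
Qed.

Lemma lazy_opE (p : S -> S -> R) v (C : R) i :
  (forall j k, 0 <= p j k) -> (forall k, 0 <= v k <= C) ->
  (\esum_(k in [set: S]) (p i k)%:E = 1)%E ->
  lazy_op p (fun k => (v k)%:E) i = (v i + mean (p i) v)%:E.
Proof.
move=> p0 vC p1; rewrite EFinD (@meanE _ _ C)// /lazy_op.
have v0 k : 0 <= v k by have /andP[] := vC k.
rewrite [in RHS](_ : (v i)%:E = (\esum_(k in [set: S]) ((v i)%:E * (p i k)%:E))%E); last first.
  by rewrite esumZl ?p1 ?mule1// => k; rewrite lee_fin.
rewrite -esumD.
- by apply: eq_esum => k _; rewrite muleDr// (muleC (v i)%:E).
- by move=> k _; rewrite mule_ge0 ?lee_fin.
- by move=> k _; rewrite lee_fin mulr_ge0.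
Qed.

End mean.

Section unif_deriv.
Context {R : realType} {f df : R -> R}.
Hypothesis fdf : forall e : R, 0 < e -> \forall h \near 0^'+, forall s : R, 0 <= s ->
  `|(f (s + h) - f s) / h - df s| <= e.

Lemma unif_deriv_cvg (s : R) : 0 <= s ->
  (f (s + h) - f s) / h @[h --> 0^'+] --> df s.
Proof.
move=> s0; apply/cvgrPdist_le => e e0.
by have := fdf e0; apply: filterS => h H; rewrite distrC H.
Qed.

Lemma unif_deriv_continuous (C : R) : (forall s, 0 <= s -> `|df s| <= C) ->
  forall e : R, 0 < e -> \forall h \near 0^'+, forall s : R, 0 <= s ->
    `|f (s + h) - f s| <= e.
Proof.
move=> dfC e e0; have C0 : 0 <= C by exact: le_trans (dfC 0 (lexx 0)).
near=> h => s s0.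
have h0 : 0 < h by near: h; exact: nbhs_right_gt.
have : `|(f (s + h) - f s) / h - df s| <= 1.
  by move: s s0; near: h; exact: fdf.
have : h < e / (C + 1) by near: h; apply: nbhs_right_lt; rewrite divr_gt0//; lra.
rewrite ltr_pdivlMr; last lra.
move=> he H; rewrite -[X in `|X|](divfK (lt0r_neq0 h0)) normrM (gtr0_norm h0).
apply: le_trans (ltW he); rewrite mulrC ler_pM2l//.
have -> : (f (s + h) - f s) / h = df s + ((f (s + h) - f s) / h - df s) by ring.
by rewrite (le_trans (ler_normD _ _))// lerD// dfC.
Unshelve. all: by end_near. Qed.

End unif_deriv.

Section walk_series.
Context {R : realType} {S : countType}.
Variable p : S -> S -> R.
Hypothesis p0 : forall i j, 0 <= p i j.
Hypothesis p1 : forall i, (\esum_(j in [set: S]) (p i j)%:E = 1)%E.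
Variable q : R -> S -> S -> R.
Hypothesis hq : walk_transition p q.

Lemma walk_le1 t i j : 0 <= t -> q t i j <= 1.
Proof.
move=> t0; rewrite -lee_fin -(walk_sum1 hq i t0).
have := @le_sum_esum R S [:: j] (fun k => (q t i k)%:E) isT.
by rewrite big_seq1.
Qed.

(* Only finitely many sites, carrying almost all the mass of [p i], matter, hence
   the uniformity in [v]; used for [v] and [1 - v], this bounds both sides. *)
Lemma walk_mean_ge i (e : R) : 0 < e -> \forall h \near 0^'+,
  forall v : S -> R, (forall k, 0 <= v k <= 1) ->
  h * (mean (p i) v - v i - e) <= mean (q h i) v - v i.
Proof.
move=> e0; have e20 : 0 < e / 2 by rewrite divr_gt0.
have [K [uK iK]] := @esum_sum_near R S (fun k => (p i k)%:E) i (e / 2) e20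
  (fun k => p0 i k) ltac:(by rewrite p1).
rewrite p1 sumEFin -EFinD lee_fin => Kp.
(* Half of [e] pays for the mass of [p i] outside [K]; the other half is shared equally among the
   sites of [K] as the error on their rates. *)
pose eta := e / 2 / (size K)%:R.
have K0 : 0 < (size K)%:R :> R by rewrite ltr0n; case: (K) iK.
have eta0 : 0 < eta by rewrite divr_gt0.
near=> h => v v1.
have h0 : 0 < h by near: h; exact: nbhs_right_gt.
have qh k : k \in K -> h * (p i k - (i == k)%:R - eta) <= q h i k - (i == k)%:R.
  move: k; near: h; apply: near_seq_forall => k.
  have /cvgrPdist_le/(_ _ eta0) := @walk_rate _ _ _ _ hq i k.
  apply: filter_app; near=> h; rewrite ler_distlC => /andP[+ _].
  have h0 : 0 < h by near: h; exact: nbhs_right_gt.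
  by rewrite ler_pdivlMr// mulrC.
have q0 k : 0 <= q h i k by apply: (walk_ge0 hq); exact: ltW.
have qm : \sum_(k <- K) q h i k * v k <= mean (q h i) v.
  exact: le_sum_mean q0 v1 (walk_sum1 hq i (ltW h0)) uK.
apply: (@le_trans _ _ (\sum_(k <- K) q h i k * v k - v i)); last by rewrite lerD2r.
have dK (c : S -> R) : \sum_(k <- K) (i == k)%:R * c k = c i.
  rewrite (bigD1_seq i)//= eqxx mul1r big1 ?addr0// => k.
  by rewrite eq_sym => /negbTE->; rewrite mul0r.
(* Dropping the sites outside [K] bounds a mean from below, so it is done for [1 - v], and [Kp]
   accounts for the missing mass. *)
have pm : mean (p i) v <= \sum_(k <- K) p i k * v k + e / 2.
  have v1' k : 0 <= 1 - v k <= 1 by have := v1 k; lra.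
  have := @le_sum_mean _ _ _ _ 1 K (p0 i) v1' (p1 i) uK.
  rewrite mean_compl//.
  under eq_bigr do rewrite mulrBr mulr1.
  by rewrite sumrB; lra.
have : \sum_(k <- K) h * (p i k - (i == k)%:R - eta) * v k <=
    \sum_(k <- K) (q h i k - (i == k)%:R) * v k.
  rewrite big_seq [leRHS]big_seq; apply: ler_sum => k kK.
  by rewrite ler_wpM2r ?qh//; have /andP[] := v1 k.
under [leRHS]eq_bigr do rewrite mulrBl.
rewrite sumrB dK; apply: le_trans.
under eq_bigr do rewrite -mulrA mulrBl mulrBl.
rewrite -mulr_sumr !sumrB dK ler_pM2l//.
have : \sum_(k <- K) eta * v k <= e / 2.
  have -> : e / 2 = \sum_(k <- K) eta.
    by rewrite big_const_seq count_predT iter_addr addr0 -[RHS]mulr_natr divfK ?gt_eqF.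
  by apply: ler_sum => k _; have := v1 k; nra.
by lra.
Unshelve. all: by end_near. Qed.

(** The short time [h] is run first, which leads to the backward equation, with [q s ^~ j] as the
    averaged function. *)
Lemma walk_meanE s h i j : 0 <= s -> 0 <= h ->
  q (s + h) i j = mean (q h i) (q s ^~ j).
Proof.
move=> s0 h0; rewrite addrC.
by have := walk_chapman_kolmogorov hq i j h0 s0; rewrite /mean => <-.
Qed.

(** The backward equation. It is uniform in [s] because [walk_mean_ge] is uniform in [v], here
    [q s ^~ j] and its complement to 1. *)
Lemma walk_unif_deriv i j (e : R) : 0 < e -> \forall h \near 0^'+, forall s : R, 0 <= s ->
  `|(q (s + h) i j - q s i j) / h - (mean (p i) (q s ^~ j) - q s i j)| <= e.
Proof.
move=> e0; have := walk_mean_ge i e0; apply: filter_app; near=> h => H s s0.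
have h0 : 0 < h by near: h; exact: nbhs_right_gt.
have v1 k : 0 <= q s k j <= 1 by rewrite (walk_ge0 hq) ?walk_le1.
have v1' k : 0 <= 1 - q s k j <= 1 by have := v1 k; lra.
rewrite walk_meanE ?(ltW h0)//.
have := H _ v1; have := H _ v1'.
have q0 k : 0 <= q h i k by apply: (walk_ge0 hq); exact: ltW.
have q1 := walk_sum1 hq i (ltW h0).
rewrite !mean_compl// ler_distlC => H1 H2.
rewrite lerBlDr ler_pdivrMr// -lerBlDr ler_pdivlMr//.
by apply/andP; split; nra.
Unshelve. all: by end_near. Qed.

(** The backward equation is an equality, so the family constant in the level satisfies the
    hypotheses of both comparison lemmas. *)
Lemma walk_series t i j : 0 <= t ->
  ((expR (2 * t) * q t i j)%:E = \sum_(n <oo) ((t ^+ n / n`!%:R)%:E *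
    iter n (lazy_op p) (fun k => (k == j)%:R%:E) i))%E.
Proof.
move=> t0; pose a k : \bar R := ((k == j)%:R)%:E.
have a0 k : (0 <= a k)%E by rewrite lee_fin.
pose f (m : nat) (s : R) k := q s k j.
pose df (m : nat) (s : R) k := mean (p k) (q s ^~ j) - q s k j.
have f0 (m : nat) (s : R) k : 0 <= s -> 0 <= f m s k by move=> s0; exact: walk_ge0 hq _ _ _ s0.
have v1 (s : R) : 0 <= s -> forall k, 0 <= q s k j <= 1.
  by move=> s0 k; rewrite (walk_ge0 hq) ?walk_le1.
have df1 k (s : R) : 0 <= s -> `|df 0 s k| <= 1.
  (* The empty sum, for [v] and for [1 - v], places the mean in [[0, 1]]. *)
  move=> s0; have := v1 s s0 k; have := le_sum_mean (p0 k) (v1 s s0) (p1 k) (K := [::]) isT.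
  have v1' l : 0 <= 1 - q s l j <= 1 by have := v1 s s0 l; lra.
  have := le_sum_mean (p0 k) v1' (p1 k) (K := [::]) isT.
  by rewrite mean_compl ?big_nil//; [move=> *; rewrite ler_norml /df; lra|exact: v1].
have fu (m : nat) k := unif_deriv_continuous (walk_unif_deriv k j) (df1 k).
have fd (m : nat) k := unif_deriv_cvg (walk_unif_deriv k j).
have fdf (m : nat) (s : R) k : 0 <= s ->
    (df m s k + 2 * f m s k)%:E = lazy_op p (fun j => (f m s j)%:E) k.
  by move=> s0; rewrite (@lazy_opE _ _ _ _ 1)//; [congr (_%:E); rewrite /df /f; ring|exact: v1].
apply/eqP; rewrite eq_le; apply/andP; split.
  apply: (@lazy_exp_series_ge R S p p0 p1 f df f0 fu fd a a0 1 _ _ _ 0) => //.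
  - by move=> m s k s0; rewrite mulr1 (le_trans (walk_le1 _ _ s0))// exprn_ege1 ?ler1n.
  - by move=> m k; rewrite /f (walk_0 hq).
  - by move=> m s k s0; rewrite fdf.
apply: lazy_exp_series_le => // k.
apply: (@lazy_exp_sum_le R S p p0 p1 f df f0 fu fd a a0 1) => //.
- by move=> l; rewrite lee_fin; case: (l == j).
- by move=> m l; rewrite /f (walk_0 hq).
- by move=> m s l s0; rewrite -fdf.
Qed.

End walk_series.

(** * Superposition of point masses *)

Section walk_sum.
Context {R : realType} {S : countType}.
Variable p : S -> S -> R.
Hypothesis p0 : forall i j, 0 <= p i j.
Hypothesis p1 : forall i, (\esum_(j in [set: S]) (p i j)%:E = 1)%E.
Variable x : S -> R.
Hypothesis x0 : forall i, 0 <= x i.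

Local Notation delta j := (fun k : S => ((k == j)%:R%:E : \bar R)).

Let delta_ge0 j k : (0 <= delta j k)%E. Proof. by rewrite lee_fin. Qed.

Lemma iter_lazy_op_sum n i :
  iter n (lazy_op p) (fun k => (x k)%:E) i =
  (\esum_(j in [set: S]) (iter n (lazy_op p) (delta j) i * (x j)%:E))%E.
Proof.
elim: n i => [|n IHn] i /=.
  rewrite (esumID [set i])// => [|j _]; last by rewrite mule_ge0 ?lee_fin.
  rewrite setTI esum_set1 ?eqxx ?mul1e ?lee_fin// setTI esum1 ?adde0//.
  by move=> j /= /eqP/negbTE; rewrite eq_sym => ->; rewrite mul0e.
rewrite (_ : iter n _ _ = fun i => \esum_(j in [set: S])
  (iter n (lazy_op p) (delta j) i * (x j)%:E)%E); last exact/funext.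
have d0 j k : (0 <= iter n (lazy_op p) (delta j) k)%E by exact: iter_lazy_op_ge0.
rewrite /lazy_op.
transitivity (\esum_(k in [set: S]) \esum_(j in [set: S]) ((p i k)%:E *
  (iter n (lazy_op p) (delta j) i + iter n (lazy_op p) (delta j) k) * (x j)%:E))%E.
  apply: eq_esum => k _; rewrite -esumD => [|j _|j _]; last 2 first.
  - by rewrite mule_ge0 ?lee_fin.
  - by rewrite mule_ge0 ?lee_fin.
  rewrite -esumZl => [|//|j]; last by rewrite adde_ge0 ?mule_ge0 ?lee_fin.
  by apply: eq_esum => j _; rewrite -ge0_muleDl// muleA.
rewrite exchange_esum => [|k j]; last first.
  by rewrite mule_ge0 ?lee_fin// mule_ge0 ?adde_ge0 ?lee_fin.
apply: eq_esum => j _; rewrite muleC -esumZl => [|//|k]; last first.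
  by rewrite mule_ge0 ?adde_ge0 ?lee_fin.
by apply: eq_esum => k _; rewrite muleC.
Qed.

(** The initial condition is split into point masses, to which [walk_series] applies. All terms are
    nonnegative, so the sums may be exchanged even when they are infinite. *)
Lemma walk_series_sum (q : R -> S -> S -> R) (t : R) i :
  walk_transition p q -> 0 <= t ->
  (\sum_(n <oo) ((t ^+ n / n`!%:R)%:E * iter n (lazy_op p) (fun k => (x k)%:E) i) =
   (expR (2 * t))%:E * \esum_(j in [set: S]) (q t i j * x j)%:E)%E.
Proof.
move=> hq t0.
have c0 n : 0 <= t ^+ n / n`!%:R :> R by rewrite divr_ge0 ?exprn_ge0.
have d0 n j k : (0 <= iter n (lazy_op p) (delta j) k)%E by exact: iter_lazy_op_ge0.
rewrite nneseries_esumT => [|n]; last first.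
  by rewrite mule_ge0 ?lee_fin// iter_lazy_op_ge0// => j; rewrite lee_fin.
rewrite -esumZl ?expR_ge0// => [|j]; last by rewrite lee_fin mulr_ge0 ?(walk_ge0 hq).
transitivity (\esum_(n in [set: nat]) \esum_(j in [set: S])
    ((x j)%:E * ((t ^+ n / n`!%:R)%:E * iter n (lazy_op p) (delta j) i)))%E.
  apply: eq_esum => n _; rewrite iter_lazy_op_sum -esumZl => [|//|j]; last first.
    by rewrite mule_ge0 ?lee_fin.
  by apply: eq_esum => j _; rewrite muleA muleC.
rewrite exchange_esum => [|n j]; last by rewrite !mule_ge0 ?lee_fin.
apply: eq_esum => j _; rewrite esumZl => [|//|n]; last by rewrite mule_ge0 ?lee_fin.
rewrite -nneseries_esumT => [|n]; last by rewrite mule_ge0 ?lee_fin.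
by rewrite -(walk_series p0 p1 hq)// -!EFinM; congr (_%:E); ring.
Qed.

End walk_sum.
(** * The exchange generator on clipped coordinates *)

Section integral_unit_interval.
Context {R : realType}.
Local Notation mu := (@lebesgue_measure R).
Local Notation I01 := ([set` `[0, 1]] : set R).

Lemma Rintegral01_affine (a b : R) :
  \int[mu]_(u in `[0, 1]) (a + b * u) = a + b / 2.
Proof.
pose F : {poly R} := (b / 2) *: 'X^2 + a *: 'X.
have FE u : F.[u] = b / 2 * u ^+ 2 + a * u by rewrite /F !hornerE.
have Fc := @continuous_horner _ F.
rewrite /Rintegral (@continuous_FTC2 _ _ (horner F) 0 1)//.
- by rewrite -EFinB/= !FE; ring.
- apply: continuous_subspaceT => u; apply: cvgD; first exact: cvg_cst.
  exact: mulrl_continuous.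
- split => [u _||]; first exact: derivable_horner.
    exact/cvg_at_right_filter/Fc.
  exact/cvg_at_left_filter/Fc.
- by move=> u _; rewrite -derivE /F derivD !derivZ derivX derivXn !hornerE; field.
Qed.

Lemma integrable01_affine (a b : R) :
  mu.-integrable `[0, 1] (EFin \o (fun u => a + b * u)).
Proof.
apply: continuous_compact_integrable; first exact: segment_compact.
apply: continuous_subspaceT => u; apply: cvgD; first exact: cvg_cst.
exact: mulrl_continuous.
Qed.

Lemma integrable01_bounded (g : R -> R) (a b a' b' : R) :
  measurable_fun I01 g ->
  (forall u, 0 <= u <= 1 -> a + b * u <= g u <= a' + b' * u) ->
  mu.-integrable `[0, 1] (EFin \o g).
Proof.
move=> mg ag.
have gM (u : R) : 0 <= u <= 1 -> `|g u| <= `|a| + `|b| + `|a'| + `|b'|.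
  move=> u01; have := ag u u01.
  have h (c : R) : `|c * u| <= `|c|.
    by rewrite normrM ler_piMr// ger0_norm//; case/andP: u01.
  have := h b; have := h b'; have := ler_norm (b' * u); have := ler_norm (- (b * u)).
  have := ler_norm a'; have := ler_norm (- a); have := normr_ge0 a'; have := normr_ge0 a.
  have := normr_ge0 (b' * u); have := normr_ge0 (b * u).
  by rewrite !normrN [_ <= _ + _ + _ + _]ler_norml => *; apply/andP; split; lra.
apply: measurable_bounded_integrable => //.
  by rewrite /= lebesgue_measure_itv/= lte01 oppr0 adde0 ltry.
exists (`|a| + `|b| + `|a'| + `|b'|); split; first exact: num_real.
move=> M aM u /=; rewrite in_itv/= => u01; apply: le_trans (ltW aM).
exact: gM.
Qed.

Lemma Rintegral01_affine_bounds (g : R -> R) (a b a' b' : R) :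
  measurable_fun I01 g ->
  (forall u, 0 <= u <= 1 -> a + b * u <= g u <= a' + b' * u) ->
  a + b / 2 <= \int[mu]_(u in `[0, 1]) g u <= a' + b' / 2.
Proof.
move=> mg ag; have ig := integrable01_bounded mg ag.
rewrite -!Rintegral01_affine; apply/andP; split.
  apply: le_Rintegral => //; first exact: integrable01_affine.
  by move=> u /=; rewrite in_itv/= => /ag /andP[].
apply: le_Rintegral => //; first exact: integrable01_affine.
by move=> u /=; rewrite in_itv/= => /ag /andP[].
Qed.

Let clip (a b c N C v u : R) := Num.min (a + b * u + c * v) N - C.

Let continuous_clip a b c N C v : continuous (clip a b c N C v).
Proof.
move=> u; apply: cvgB; last exact: cvg_cst.
apply: (@continuous_min _ _ (fun u => a + b * u + c * v) (cst N)); last exact: cvg_cst.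
apply: cvgD; last exact: cvg_cst.
by apply: cvgD; [exact: cvg_cst|exact: mulrl_continuous].
Qed.

Let measurable_clip a b c N C v : measurable_fun I01 (clip a b c N C v).
Proof. by apply: measurable_funTS; exact: continuous_measurable_fun. Qed.

Let integrable_clip a b c N C v :
  mu.-integrable `[0, 1] (EFin \o clip a b c N C v).
Proof.
apply: continuous_compact_integrable; first exact: segment_compact.
exact: continuous_subspaceT.
Qed.

(** The inner integral is monotone in [v], in the direction given by the sign of [c], and monotone
    functions are measurable. *)
Let measurable_int_clip a b c N C :
  measurable_fun I01 (fun v => \int[mu]_(u in `[0, 1]) clip a b c N C v u).
Proof.
have mono (v w : R) : c * v <= c * w ->
    \int[mu]_(u in `[0, 1]) clip a b c N C v u <=
    \int[mu]_(u in `[0, 1]) clip a b c N C w u.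
  move=> vw; apply: le_Rintegral => // u _.
  rewrite /clip lerB// le_min !ge_min lexx orbT andbT; apply/orP; left.
  by rewrite lerD2l.
case: (leP 0 c) => c0.
  apply: nondecreasing_measurable => // v w vw; apply: mono.
  by rewrite ler_wpM2l.
apply: nonincreasing_measurable => // v w vw; apply: mono.
by rewrite ler_wnM2l// ltW.
Qed.

(** Affine bounds are integrated in [u], then in [v]; each variable has mean [1 / 2]. *)
Lemma Rintegral01_clip_bounds (a b c N C l0 l1 l2 r0 r1 r2 : R) :
  (forall u v, 0 <= u <= 1 -> 0 <= v <= 1 ->
    l0 + l1 * u + l2 * v <= Num.min (a + b * u + c * v) N - C <= r0 + r1 * u + r2 * v) ->
  l0 + l1 / 2 + l2 / 2 <=
  \int[mu]_(v in `[0, 1]) \int[mu]_(u in `[0, 1]) (Num.min (a + b * u + c * v) N - C)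
  <= r0 + r1 / 2 + r2 / 2.
Proof.
move=> lr; apply: Rintegral01_affine_bounds; first exact: measurable_int_clip.
move=> v v01; have := @Rintegral01_affine_bounds (clip a b c N C v)
  (l0 + l2 * v) l1 (r0 + r2 * v) r1 (measurable_clip _ _ _ _ _ _).
rewrite /clip !(addrAC _ (_ * v)) => -> //.
by move=> u u01; rewrite !(addrAC _ (_ * v)); exact: lr.
Qed.

End integral_unit_interval.
(** Reduces a signed sum to sums of nonnegative terms: [a^\+ + c = (a + c) + a^\-] termwise, and all
    four sums are finite because [a^\+ <= a + c] and [a^\- <= c]. *)
Lemma abs_sumDr (R : realType) (T : choiceType) (a c : T -> R) :
  (forall k, 0 <= c k) -> (forall k, 0 <= a k + c k) ->
  (\esum_(k in [set: T]) (c k)%:E \is a fin_num)%E ->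
  (\esum_(k in [set: T]) (a k + c k)%:E \is a fin_num)%E ->
  abs_sum a + fine (\esum_(k in [set: T]) (c k)%:E)%E =
  fine (\esum_(k in [set: T]) (a k + c k)%:E)%E.
Proof.
move=> c0 ac0 cfin acfin.
have le_fin (b b' : T -> R) : (forall k, 0 <= b k <= b' k) ->
    (\esum_(k in [set: T]) (b' k)%:E \is a fin_num)%E ->
    (\esum_(k in [set: T]) (b k)%:E \is a fin_num)%E.
  move=> bb'; rewrite !ge0_fin_numE; last 2 first.
  - by apply: esum_ge0 => k _; have /andP[+ _] := bb' k; rewrite lee_fin.
  - apply: esum_ge0 => k _; have /andP[h1 h2] := bb' k.
    by rewrite lee_fin (le_trans h1).
  apply: le_lt_trans; apply: le_esum => k _; rewrite lee_fin.
  by have /andP[] := bb' k.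
have pos k : 0 <= a^\+ k <= a k + c k.
  by rewrite /funrpos le_max lexx orbT/= ge_max ac0 lerDl c0.
have neg k : 0 <= a^\- k <= c k.
  by rewrite /funrneg le_max lexx orbT/= ge_max c0 andbT; have := ac0 k; lra.
have posfin := le_fin _ _ pos acfin; have negfin := le_fin _ _ neg cfin.
have E : (\esum_(k in [set: T]) (a^\+ k)%:E + \esum_(k in [set: T]) (c k)%:E =
    \esum_(k in [set: T]) (a k + c k)%:E + \esum_(k in [set: T]) (a^\- k)%:E)%E.
  rewrite -!esumD; first 1 last.
  - by move=> k _; rewrite lee_fin ac0.
  - by move=> k _; rewrite lee_fin; have /andP[] := neg k.
  - by move=> k _; rewrite lee_fin; have /andP[] := pos k.
  - by move=> k _; rewrite lee_fin.
  apply: eq_esum => k _; rewrite -!EFinD; congr (_%:E).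
  by rewrite /funrpos /funrneg; case: (leP (a k) 0); case: (leP (- a k) 0); lra.
by have := congr1 fine E; rewrite !fineD// /abs_sum; lra.
Qed.

(** * Two-sided bounds for the generator on clipped coordinates *)

Section generator_bounds.
Context {R : realType} {S : countType}.
Implicit Types (y : config R S) (N : R).

Definition clip_coord N (k : S) : config R S -> R := fun y => Num.min (y k) N.

Lemma clip_coord_ge0 N k y : 0 <= N -> 0 <= clip_coord N k y.
Proof. by move=> N0; rewrite le_min coord_ge0. Qed.

Lemma clip_coord_le N k y : clip_coord N k y <= N.
Proof. by rewrite ge_min lexx orbT. Qed.

Lemma clip_coord_mono N N' k y : N <= N' -> clip_coord N k y <= clip_coord N' k y.
Proof. by move=> NN'; rewrite /clip_coord le_min !ge_min lexx NN' orbT. Qed.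

Lemma exchange_fst y i j (u v : R) : 0 <= u <= 1 -> 0 <= v <= 1 ->
  exchange y i j u v i = y i * (1 - u) + y j * v :> R.
Proof.
move=> /andP[u0 u1] /andP[v0 v1]; rewrite /exchange/= /exchange_fun eqxx max_r//.
by rewrite addr_ge0// mulr_ge0 ?coord_ge0// subr_ge0.
Qed.

Lemma exchange_snd y i j (u v : R) : i != j -> 0 <= u <= 1 -> 0 <= v <= 1 ->
  exchange y i j u v j = y j * (1 - v) + y i * u :> R.
Proof.
move=> ij /andP[u0 u1] /andP[v0 v1].
rewrite /exchange/= /exchange_fun eq_sym (negbTE ij) eqxx max_r//.
by rewrite addr_ge0// mulr_ge0 ?coord_ge0// subr_ge0.
Qed.

Lemma exchange_other y i j (u v : R) k : k != i -> k != j ->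
  exchange y i j u v k = y k :> R.
Proof.
move=> ki kj; rewrite /exchange/= /exchange_fun (negbTE ki) (negbTE kj) max_r//.
exact: coord_ge0.
Qed.

Let jump N k y i j : R :=
  \int[lebesgue_measure]_(v in `[0, 1]) \int[lebesgue_measure]_(u in `[0, 1])
    (clip_coord N k (exchange y i j u v) - clip_coord N k y).

(* [al N X * s + be N X] is an affine upper bound of [min(X * s, N)] on [0, 1]
   with mean [min(X, 2 * N) / 2]. *)
Let al N X := if X <= 2 * N then X else 0.
Let be N X := if X <= 2 * N then 0 else N.

(** On the left, each summand is at most [N / 2], and at most [A * s], respectively [B * t]. On the
    right, if [A] or [B] exceeds [2 * N] its majorant is the constant [N], which already suffices;
    otherwise the majorant is the sum itself. *)
Lemma min_mix_bounds (A B N s t : R) : 0 <= A -> 0 <= B -> 0 <= N ->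
  0 <= s <= 1 -> 0 <= t <= 1 ->
  Num.min A (N / 2) * s + Num.min B (N / 2) * t <= Num.min (A * s + B * t) N <=
  al N A * s + be N A + (al N B * t + be N B).
Proof.
move=> A0 B0 N0 /andP[s0 s1] /andP[t0 t1].
apply/andP; split.
  rewrite le_min lerD ?ler_wpM2r ?ge_min ?lexx//=.
  have h (X r : R) : 0 <= r -> r <= 1 -> Num.min X (N / 2) * r <= N / 2.
    move=> r0 r1; apply: (@le_trans _ _ (N / 2 * r)).
      by rewrite ler_wpM2r// ge_min lexx orbT.
    by rewrite ler_piMr// divr_ge0.
  by have := h A s s0 s1; have := h B t t0 t1; lra.
have As : 0 <= A * s by rewrite mulr_ge0.
have Bt : 0 <= B * t by rewrite mulr_ge0.
rewrite /al /be ge_min; case: ifP => _; case: ifP => _; rewrite ?mul0r ?add0r ?addr0 ?lexx//.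
- by rewrite lerDr As orbT.
- by rewrite lerDl Bt orbT.
- by rewrite lerDl N0 orbT.
Qed.

Lemma half_min (X N : R) : 0 <= N ->
  al N X / 2 + be N X = Num.min X (2 * N) / 2.
Proof. by move=> N0; rewrite /al /be; case: ifP; case: leP => // _ _; field. Qed.

(** The generator runs over ordered pairs, so [k] may be the first or the second member; the two
    cases differ by the roles of [u] and [v]. *)
Lemma jump_bounds N k j y : 0 <= N -> k != j ->
  let lo := (clip_coord (N / 2) k y + clip_coord (N / 2) j y) / 2 - clip_coord N k y in
  let up := (clip_coord (2 * N) k y + clip_coord (2 * N) j y) / 2 - clip_coord N k y in
  lo <= jump N k y k j <= up /\ lo <= jump N k y j k <= up.
Proof.
move=> N0 kj lo up.
have A0 := coord_ge0 y k; have B0 := coord_ge0 y j.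
have hA := half_min (y k) N0; have hB := half_min (y j) N0.
set a1 := Num.min (y k) (N / 2); set b1 := Num.min (y j) (N / 2).
set C := clip_coord N k y.
have loE : lo = (a1 + b1) / 2 - C by [].
have upE : up = al N (y k) / 2 + be N (y k) + (al N (y j) / 2 + be N (y j)) - C.
  rewrite (_ : al N (y k) / 2 + _ = Num.min (y k) (2 * N) / 2)//.
  by rewrite hB /up /C /clip_coord; field.
split.
- rewrite /jump (_ : Rintegral _ _ _ = \int[lebesgue_measure]_(v in `[0, 1])
      \int[lebesgue_measure]_(u in `[0, 1]) (Num.min (y k + (- y k) * u + y j * v) N - C)).
    (* The coefficients are those of [min_mix_bounds] at [s = 1 - u] and [t = v], expanded in [u]
       and [v] and lowered by [C]. *)
    have := @Rintegral01_clip_bounds R (y k) (- y k) (y j) N C (a1 - C) (- a1) b1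
      (al N (y k) + be N (y k) + be N (y j) - C) (- al N (y k)) (al N (y j)).
    have -> : a1 - C + - a1 / 2 + b1 / 2 = lo by rewrite loE; field.
    have -> : al N (y k) + be N (y k) + be N (y j) - C + - al N (y k) / 2 + al N (y j) / 2 = up.
      by rewrite upE; field.
    apply => u v u01 v01.
    have u01' : 0 <= 1 - u <= 1 by lra.
    have := min_mix_bounds A0 B0 N0 u01' v01.
    rewrite -/a1 -/b1.
    have -> : y k + - y k * u + y j * v = y k * (1 - u) + y j * v by ring.
    by move=> /andP[? ?]; apply/andP; split; lra.
  apply: eq_Rintegral => v; rewrite inE/= in_itv/= => v01.
  apply: eq_Rintegral => u; rewrite inE/= in_itv/= => u01.
  by rewrite {1}/clip_coord exchange_fst//; congr (Num.min _ _ - _); ring.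
- rewrite /jump (_ : Rintegral _ _ _ = \int[lebesgue_measure]_(v in `[0, 1])
      \int[lebesgue_measure]_(u in `[0, 1]) (Num.min (y k + y j * u + (- y k) * v) N - C)).
    have := @Rintegral01_clip_bounds R (y k) (y j) (- y k) N C (a1 - C) b1 (- a1)
      (al N (y k) + be N (y k) + be N (y j) - C) (al N (y j)) (- al N (y k)).
    have -> : a1 - C + b1 / 2 + - a1 / 2 = lo by rewrite loE; field.
    have -> : al N (y k) + be N (y k) + be N (y j) - C + al N (y j) / 2 + - al N (y k) / 2 = up.
      by rewrite upE; field.
    apply => u v u01 v01.
    have v01' : 0 <= 1 - v <= 1 by lra.
    have := min_mix_bounds A0 B0 N0 v01' u01.
    rewrite -/a1 -/b1.
    have -> : y k + y j * u + - y k * v = y k * (1 - v) + y j * u by ring.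
    by move=> /andP[? ?]; apply/andP; split; lra.
  apply: eq_Rintegral => v; rewrite inE/= in_itv/= => v01.
  apply: eq_Rintegral => u; rewrite inE/= in_itv/= => u01.
  by rewrite {1}/clip_coord exchange_snd 1?eq_sym//; congr (Num.min _ _ - _); ring.
Qed.

Lemma jump_other N k y i j : k != i -> k != j -> jump N k y i j = 0.
Proof.
move=> ki kj; rewrite /jump.
rewrite (_ : Rintegral _ _ _ = \int[lebesgue_measure]_(v in `[0, 1]) (cst 0 v : R)).
  by rewrite Rintegral_cst// mul0r.
apply: eq_Rintegral => v _.
rewrite -[RHS](_ : \int[lebesgue_measure]_(u in `[0, 1]) (cst 0 u : R) = _); last first.
  by rewrite Rintegral_cst// mul0r.
by apply: eq_Rintegral => u _; rewrite /clip_coord exchange_other// subrr.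
Qed.

(** The site [k] is counted once as first and once as second member, and symmetry makes the two
    counts equal. The diagonal pair has weight 2, in agreement with the term [j = k] on the
    right. *)
Lemma esum_pairs_meeting (G : S -> S -> R) k :
  (forall i j, 0 <= G i j) -> (forall i j, G i j = G j i) ->
  (\esum_(z in [set: S * S]) (((z.1 == k)%:R + (z.2 == k)%:R) * G z.1 z.2)%:E =
   \esum_(j in [set: S]) (2 * G k j)%:E)%E.
Proof.
move=> G0 Gs.
have pick (F : S -> R) : (forall i, 0 <= F i) ->
    (\esum_(i in [set: S]) ((i == k)%:R * F i)%:E = (F k)%:E)%E.
  move=> F0; rewrite (esumID [set k])// => [|i _]; last by rewrite lee_fin mulr_ge0.
  rewrite setTI esum_set1 ?eqxx ?mul1r ?lee_fin// setTI esum1 ?adde0//.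
  by move=> i /= /eqP/negbTE ->; rewrite mul0r.
have e0 i j l : (0 <= ((i == j :> S)%:R * G i l)%:E)%E by rewrite lee_fin mulr_ge0.
rewrite -[LHS](_ : \esum_(i in [set: S]) \esum_(j in [set: S])
    (((i == k)%:R + (j == k)%:R) * G i j)%:E = _)%E; last first.
  rewrite esum_esum => [|i j _ _]; last by rewrite lee_fin mulr_ge0 ?addr_ge0.
  by congr esum; apply/seteqP; split.
transitivity (\esum_(i in [set: S]) \esum_(j in [set: S]) ((i == k)%:R * G i j)%:E +
    \esum_(i in [set: S]) \esum_(j in [set: S]) ((j == k)%:R * G j i)%:E)%E.
  rewrite -esumD => [|i _|i _]; last 2 first.
  - by apply: esum_ge0 => j _.
  - by apply: esum_ge0 => j _.
  apply: eq_esum => i _; rewrite -esumD => [|j _|j _]; [|exact: e0..].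
  by apply: eq_esum => j _; rewrite -EFinD mulrDl (Gs j).
rewrite exchange_esum; last by move=> i j; exact: e0.
rewrite -esumD => [|j _|j _]; last 2 first.
- by apply: esum_ge0 => i _.
- by apply: esum_ge0 => i _.
apply: eq_esum => j _; rewrite !pick// -EFinD; congr (_%:E); ring.
Qed.

Variable p : S -> S -> R.
Hypothesis hp : irreducible_symmetric_kernel p.

Let p0 i j : 0 <= p i j. Proof. exact: kernel_ge0 hp i j. Qed.
Let p1 i := kernel_sum1 hp i.
Let ps i j : p i j = p j i. Proof. exact: kernel_sym hp i j. Qed.

Lemma exchange_generator_bounds N k y : 0 <= N ->
  (lazy_op p (fun l => (clip_coord (N / 2) l y)%:E) k <=
    (exchange_generator p (clip_coord N k) y + 2 * clip_coord N k y)%:E <=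
  lazy_op p (fun l => (clip_coord (2 * N) l y)%:E) k)%E.
Proof.
move=> N0.
have N20 : 0 <= N / 2 by rewrite divr_ge0.
have tN0 : 0 <= 2 * N by rewrite mulr_ge0.
pose G M i j := p i j * ((clip_coord M i y + clip_coord M j y) / 2).
have G0 M i j : 0 <= M -> 0 <= G M i j.
  by move=> M0; rewrite mulr_ge0// divr_ge0// addr_ge0 ?clip_coord_ge0.
have Gs M i j : G M i j = G M j i by rewrite /G ps addrC.
have GE M : 0 <= M -> (\esum_(z in [set: S * S])
    (((z.1 == k)%:R + (z.2 == k)%:R) * G M z.1 z.2)%:E =
    lazy_op p (fun l => (clip_coord M l y)%:E) k)%E.
  move=> M0; rewrite esum_pairs_meeting//; last by move=> i j; exact: G0.
  by apply: eq_esum => j _; rewrite -EFinD -EFinM; congr (_%:E); rewrite /G; field.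
(* The total of [c] is [2 * clip_coord N k y]. Adding [c] makes every term of the generator
   nonnegative, as [abs_sumDr] requires. *)
pose c (z : S * S) := ((z.1 == k)%:R + (z.2 == k)%:R) * (p z.1 z.2 * clip_coord N k y).
have c0 z : 0 <= c z by rewrite mulr_ge0 ?addr_ge0// mulr_ge0 ?clip_coord_ge0.
have cE : (\esum_(z in [set: S * S]) (c z)%:E)%E = (2 * clip_coord N k y)%:E.
  rewrite (@esum_pairs_meeting (fun i j => p i j * clip_coord N k y)).
  - under eq_esum do rewrite mulrCA mulrC EFinM.
    by rewrite esumZl ?p1 ?mule1// ?mulr_ge0 ?clip_coord_ge0// => j; rewrite lee_fin.
  - by move=> i j; rewrite mulr_ge0 ?clip_coord_ge0.
  - by move=> i j; rewrite ps.
pose a (z : S * S) := if z.1 == z.2 then 0 else p z.1 z.2 * jump N k y z.1 z.2.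
have aE : exchange_generator p (clip_coord N k) y = abs_sum a by [].
have ac z : ((z.1 == k)%:R + (z.2 == k)%:R) * G (N / 2) z.1 z.2 <= a z + c z <=
    ((z.1 == k)%:R + (z.2 == k)%:R) * G (2 * N) z.1 z.2.
  case: z => i j; rewrite /a /c /G/=.
  (* A diagonal pair adds nothing to the generator but appears in [c] and [G]; there the bounds are
     monotonicity of the clipping in its level. *)
  have [->|ij] := eqVneq i j.
    rewrite add0r; have [->|jk] := eqVneq j k; last by rewrite addr0 !mul0r lexx.
    rewrite !(ler_wpM2l (addr_ge0 _ _))// !ler_wpM2l//.
      by have := @clip_coord_mono N (2 * N) k y; lra.
    by have := @clip_coord_mono (N / 2) N k y; lra.
  have [ik|ik] := eqVneq i k; have [jk|jk] := eqVneq j k.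
  - by rewrite ik jk eqxx in ij.
  - rewrite ik in ij *; have [/andP[h1 h2] _] := jump_bounds y N0 ij.
    by rewrite addr0 !mul1r -mulrDr !ler_wpM2l//; lra.
  - rewrite jk in ij *; rewrite eq_sym in ij.
    have [_ /andP[h1 h2]] := jump_bounds y N0 ij.
    rewrite add0r !mul1r -mulrDr (addrC (clip_coord _ i y)) (addrC (clip_coord _ i y)).
    by rewrite !ler_wpM2l//; lra.
  - by rewrite addr0 !mul0r jump_other 1?eq_sym// mulr0 addr0 lexx.
have ac0 z : 0 <= a z + c z.
  have /andP[+ _] := ac z; apply: le_trans.
  by rewrite mulr_ge0 ?addr_ge0// G0.
have Jle M : 0 <= M -> (lazy_op p (fun l => (clip_coord M l y)%:E) k \is a fin_num)%E.
  move=> M0; rewrite ge0_fin_numE; last first.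
    by apply: lazy_op_ge0 => // l; rewrite lee_fin clip_coord_ge0.
  apply: (@le_lt_trans _ _ (lazy_op p (fun=> M%:E) k)).
    by apply: le_lazy_op => // l; rewrite lee_fin clip_coord_le.
  by rewrite lazy_op_cst// ltry.
have acup : (\esum_(z in [set: S * S]) (a z + c z)%:E <=
    lazy_op p (fun l => (clip_coord (2 * N) l y)%:E) k)%E.
  rewrite -GE//; apply: le_esum => z _.
  by rewrite lee_fin; have /andP[] := ac z.
have acfin : (\esum_(z in [set: S * S]) (a z + c z)%:E \is a fin_num)%E.
  rewrite ge0_fin_numE ?esum_ge0//; last by move=> z _; rewrite lee_fin.
  by rewrite (le_lt_trans acup)// -ge0_fin_numE ?Jle// -GE// esum_ge0// => z _;
     rewrite lee_fin mulr_ge0 ?addr_ge0 ?G0.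
have := abs_sumDr c0 ac0; rewrite cE/= => /(_ isT acfin) H.
rewrite aE H fineK// acup andbT -GE//; apply: le_esum => z _.
by rewrite lee_fin; have /andP[] := ac z.
Qed.

End generator_bounds.
(** * The semigroup on clipped coordinates *)

(** Enumerates [T] by its codes, with value 0 at the integers that code nothing, so that results on
    series indexed by [nat] apply. *)
Lemma esum_pickle (R : realType) (T : countType) (a : T -> \bar R) :
  (forall t, 0 <= a t)%E ->
  (\esum_(t in [set: T]) a t = \sum_(n <oo) oapp a 0%E (pickle_inv n))%E.
Proof.
move=> a0.
have b0 n : (0 <= oapp a 0%E (@pickle_inv T n))%E by case: pickle_inv.
rewrite nneseries_esumT// (esumID (range (@pickle T)))// setTI.
rewrite [X in (_ = _ + X)%E]esum1 ?adde0; last first.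
  move=> n [_ /= nP]; case E : (pickle_inv n) => [t|//].
  by exfalso; apply: nP; exists t => //; have := @pickle_invK T n; rewrite /oapp E.
rewrite (@reindex_esum R T nat setT (range pickle) pickle).
  by apply: eq_esum => t _; rewrite pickleK_inv.
split; [by move=> t _; exists t| |by []].
by move=> s t _ _ st; have := pickleK_inv s; rewrite st pickleK_inv => -[].
Qed.

(** * Exchange of integrals and countable sums *)

Section integral_esum.
Context d (E : measurableType d) (R : realType) (T : countType).
Variables (mu : {measure set E -> \bar R}) (F : T -> E -> \bar R).
Hypothesis F0 : forall t y, (0 <= F t y)%E.
Hypothesis mF : forall t, measurable_fun [set: E] (F t).

Let F' n y : \bar R := oapp (fun t => F t y) 0%E (@pickle_inv T n).

Let F'0 n y : (0 <= F' n y)%E. Proof. by rewrite /F'; case: pickle_inv => [t|]/=. Qed.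

Let mF' n : measurable_fun [set: E] (F' n).
Proof. by rewrite /F'; case: pickle_inv => [t|] /=; [exact: mF|exact: measurable_cst]. Qed.

Let esumE y : (\esum_(t in [set: T]) F t y = \sum_(n <oo) F' n y)%E.
Proof. exact: esum_pickle. Qed.

Lemma measurable_esum : measurable_fun [set: E] (fun y => \esum_(t in [set: T]) F t y)%E.
Proof.
rewrite (_ : (fun y => _) = (fun y => \sum_(n <oo) F' n y)%E); last exact/funext.
by apply: ge0_emeasurable_sum => n *.
Qed.

Lemma integral_esum :
  (\int[mu]_y (\esum_(t in [set: T]) F t y) = \esum_(t in [set: T]) \int[mu]_y F t y)%E.
Proof.
rewrite (eq_integral (fun y => \sum_(n <oo) F' n y)%E) => [|y _]; last exact: esumE.
rewrite (integral_nneseries mu measurableT mF' (fun n y _ => F'0 n y)).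
rewrite esum_pickle => [|t]; last exact: integral_ge0.
apply: eq_eseriesr => n _; rewrite /F'; case: pickle_inv => [t//|/=].
exact: integral0.
Qed.

End integral_esum.

Section coordinates.
Context {R : realType} {S : countType}.

Lemma measurable_coord (k : S) : measurable_fun [set: config R S] (fun y => y k).
Proof.
move=> _ B mB; rewrite setTI; apply: sub_sigma_algebra.
by exists k, B.
Qed.

Lemma measurable_clip_coord (N : R) (k : S) :
  measurable_fun [set: config R S] (clip_coord N k).
Proof. by apply: measurable_minr; [exact: measurable_coord|exact: measurable_cst]. Qed.

Lemma bounded_local_clip_coord (N : R) (k : S) : 0 <= N ->
  bounded_local (clip_coord N k).
Proof.
move=> N0; split; first exact: measurable_clip_coord.
- by exists N => y; rewrite ger0_norm ?clip_coord_ge0 ?clip_coord_le.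
- by exists [:: k] => y z /(_ k); rewrite mem_head /clip_coord => ->.
Qed.

End coordinates.

(** * Action of the semigroup on bounded measurable functions *)

Section semigroup_action.
Context d {R : realType} {E : measurableType d}.
Variable P : R -> R.-pker E ~> E.
Hypothesis hP : transition_semigroup P.
Implicit Types (f g : E -> R) (x : E).

Definition semigroup s f x : R := \int[P s x]_y f y.

Lemma bounded_integrable s x f (M : R) : measurable_fun setT f ->
  (forall y, `|f y| <= M) -> (P s x).-integrable setT (EFin \o f).
Proof.
move=> mf fM; apply: measurable_bounded_integrable => //.
  by rewrite /= prob_kernel ltry.
exists M; split; first exact: num_real.
by move=> N MN y _ /=; rewrite (le_trans (fM y))// ltW.
Qed.

Lemma semigroupE s x f (M : R) : measurable_fun setT f ->
  (forall y, `|f y| <= M) -> (semigroup s f x)%:E = (\int[P s x]_y (f y)%:E)%E.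
Proof.
move=> mf fM; rewrite /semigroup /Rintegral fineK//.
exact: integrable_fin_num (bounded_integrable s x mf fM).
Qed.

Lemma semigroup_ge0 s x f : (forall y, 0 <= f y) -> 0 <= semigroup s f x.
Proof. by move=> f0; exact: Rintegral_ge0. Qed.

Lemma le_normr_semigroup s x f (M : R) : measurable_fun setT f ->
  (forall y, `|f y| <= M) -> `|semigroup s f x| <= M.
Proof.
move=> mf fM; have fi := bounded_integrable s x mf fM.
apply: le_trans (le_normr_Rintegral _ fi) _ => //.
have -> : M = \int[P s x]_y cst M y.
  by rewrite Rintegral_cst//= prob_kernel mulr1.
apply: le_Rintegral => //.
- apply: (@bounded_integrable _ _ _ M); first exact: measurableT_comp.
  by move=> y; rewrite normr_id.
- apply: (@bounded_integrable _ _ _ `|M|); first exact: measurable_cst.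
  by move=> y; rewrite lexx.
Qed.

Lemma measurable_semigroup s f (M : R) : measurable_fun setT f ->
  (forall y, 0 <= f y <= M) -> measurable_fun setT (semigroup s f).
Proof.
move=> mf fM; apply: measurableT_comp => //.
apply: measurable_fun_integral_kernel.
- by move=> U mU; exact: measurable_kernel.
- by move=> y; rewrite lee_fin; case/andP: (fM y).
- exact/measurable_EFinP.
Qed.

Lemma semigroup0 f x : measurable_fun setT f -> (forall y, 0 <= f y) ->
  semigroup 0 f x = f x.
Proof.
move=> mf f0; rewrite /semigroup /Rintegral.
rewrite (eq_measure_integral (\d_x)) => [|A mA _]; last by have [-> //] := hP.
by rewrite integral_dirac ?diracT ?mul1e//; exact/measurable_EFinP.
Qed.

Lemma integral_semigroup_add s t x (f : E -> \bar R) : 0 <= s -> 0 <= t ->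
  measurable_fun setT f -> (forall y, 0 <= f y)%E ->
  (\int[P (s + t) x]_z f z = \int[P s x]_y \int[P t y]_z f z)%E.
Proof.
move=> s0 t0 mf f0.
rewrite -(integral_kcomp (P s) (mathcomp.analysis.kernel.kernel_snd (P t)))//.
by apply: eq_measure_integral => A mA _; exact: hP.2.
Qed.

Lemma semigroup_add s t x f (M : R) : 0 <= s -> 0 <= t ->
  measurable_fun setT f -> (forall y, 0 <= f y <= M) ->
  semigroup (s + t) f x = semigroup s (semigroup t f) x.
Proof.
move=> s0 t0 mf fM.
have fM' y : `|f y| <= M by have /andP[? ?] := fM y; rewrite ger0_norm.
have f0 y : 0 <= f y by have /andP[] := fM y.
apply: EFin_inj; rewrite (semigroupE _ _ mf fM').
rewrite (@semigroupE _ _ _ M); last 2 first.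
- exact: measurable_semigroup mf fM.
- by move=> y; exact: le_normr_semigroup.
rewrite integral_semigroup_add//; last exact/measurable_EFinP.
by apply: eq_integral => y _; rewrite (semigroupE _ _ mf fM').
Qed.

(** The difference quotient at time [s] is [semigroup s] applied to the one at time 0, and
    [semigroup s] does not increase sup norms; hence the uniformity in [s]. *)
Lemma semigroup_unif_deriv f (L : E -> R) (M M' : R) x : measurable_fun setT f ->
  (forall y, 0 <= f y <= M) -> measurable_fun setT L ->
  (forall y, `|L y| <= M') ->
  (forall e : R, 0 < e -> \forall h \near 0^'+, forall y,
    `|(semigroup h f y - f y) / h - L y| <= e) ->
  forall e : R, 0 < e -> \forall h \near 0^'+, forall s, 0 <= s ->
  `|(semigroup (s + h) f x - semigroup s f x) / h - semigroup s L x| <= e.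
Proof.
move=> mf fM mL LM fL e e0; have := fL e e0; apply: filter_app; near=> h => H s s0.
have h0 : 0 < h by near: h; exact: nbhs_right_gt.
have fM' y : `|f y| <= M by have /andP[? ?] := fM y; rewrite ger0_norm.
have mhf : measurable_fun setT (semigroup h f) by exact: measurable_semigroup mf fM.
have hfM y : `|semigroup h f y| <= M by exact: le_normr_semigroup.
rewrite (semigroup_add _ s0 (ltW h0) mf fM).
pose g y := (semigroup h f y - f y) / h - L y.
have if1 := bounded_integrable s x mhf hfM.
have if2 := bounded_integrable s x mf fM'.
have if3 := bounded_integrable s x mL LM.
have mB : measurable_fun setT (fun y => semigroup h f y - f y) by exact: measurable_funB.
have BM y : `|semigroup h f y - f y| <= M + M.
  by rewrite (le_trans (ler_normB _ _))// lerD.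
have if4 := bounded_integrable s x mB BM.
have mD : measurable_fun setT (fun y => (semigroup h f y - f y) / h).
  by apply: measurable_funM => //; exact: measurable_cst.
have DM y : `|(semigroup h f y - f y) / h| <= (M + M) / h.
  by rewrite normrM normfV (gtr0_norm h0) ler_pM2r ?invr_gt0.
have if5 := bounded_integrable s x mD DM.
rewrite (_ : _ - semigroup s L x = semigroup s g x).
  apply: le_normr_semigroup => //; apply: measurable_funB => //.
rewrite /semigroup /g RintegralB// RintegralZr// RintegralB//.
Unshelve. all: by end_near. Qed.

(** [L] is the pointwise limit of the measurable difference quotients with steps [1 / (n + 1)]. *)
Lemma measurable_generator f (L : E -> R) (M : R) : measurable_fun setT f ->
  (forall y, 0 <= f y <= M) ->
  (forall e : R, 0 < e -> \forall h \near 0^'+, forall y,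
    `|(semigroup h f y - f y) / h - L y| <= e) ->
  measurable_fun setT L.
Proof.
move=> mf fM fL.
pose g n y := (semigroup n.+1%:R^-1 f y - f y) / n.+1%:R^-1.
apply: (@measurable_fun_cvg _ _ _ setT g) => [n|y _].
  apply: measurable_funM; last exact: measurable_cst.
  by apply: measurable_funB => //; exact: measurable_semigroup mf fM.
apply/cvgrPdist_le => e e0; have [r /= r0 H] := fL e e0.
have := @cvg_harmonic R; move=> /cvgrPdist_lt/(_ r r0).
apply: filterS => n; rewrite sub0r normrN => nr.
rewrite distrC; apply: H => //.
by rewrite /ball/= sub0r normrN.
Qed.

End semigroup_action.

(** * Expectations of clipped coordinates *)

Section clipped_moments.
Context {R : realType} {S : countType}.
Variable p : S -> S -> R.
Hypothesis hp : irreducible_symmetric_kernel p.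
Variable P : R -> R.-pker (config R S) ~> (config R S).
Hypothesis hP : transition_semigroup P.
Hypothesis hL : has_generator_on P (bounded_local (S:=S)) (exchange_generator p).
Variable x : config R S.

Let p0 i j : 0 <= p i j. Proof. exact: kernel_ge0 hp i j. Qed.
Let p1 i := kernel_sum1 hp i.

Definition clipped_moment (N s : R) (k : S) : R := semigroup P s (clip_coord N k) x.

Lemma clipped_moment_ge0 N s k : 0 <= N -> 0 <= clipped_moment N s k.
Proof. by move=> N0; apply: semigroup_ge0 => y; exact: clip_coord_ge0. Qed.

Let clip_norm (N : R) (k : S) (y : config R S) : 0 <= N -> `|clip_coord N k y| <= N.
Proof. by move=> N0; rewrite ger0_norm ?clip_coord_ge0// clip_coord_le. Qed.

Lemma clipped_momentE N s k : 0 <= N ->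
  (clipped_moment N s k)%:E = (\int[P s x]_y (clip_coord N k y)%:E)%E.
Proof.
move=> N0; apply: (@semigroupE _ _ _ _ _ _ _ N) => [|y]; last exact: clip_norm.
exact: measurable_clip_coord.
Qed.

Let mclip (N : R) (k : S) :
  measurable_fun setT (fun y : config R S => (clip_coord N k y)%:E).
Proof. by apply/measurable_EFinP; exact: measurable_clip_coord. Qed.

Let mterm (N : R) (k j : S) : measurable_fun setT
  (fun y : config R S => (p k j)%:E * ((clip_coord N k y)%:E + (clip_coord N j y)%:E))%E.
Proof. by apply: measurable_funeM; exact: emeasurable_funD. Qed.

Let term_ge0 N k j (y : config R S) : 0 <= N ->
  (0 <= (p k j)%:E * ((clip_coord N k y)%:E + (clip_coord N j y)%:E))%E.
Proof. by move=> N0; rewrite mule_ge0 ?adde_ge0 ?lee_fin ?clip_coord_ge0. Qed.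

Lemma lazy_op_clipped_moment N s k : 0 <= N ->
  lazy_op p (fun l => (clipped_moment N s l)%:E) k =
  (\int[P s x]_y lazy_op p (fun l => (clip_coord N l y)%:E) k)%E.
Proof.
move=> N0; rewrite /lazy_op integral_esum//; last by move=> j y; exact: term_ge0.
apply: eq_esum => j _; rewrite ge0_integralZl_EFin//; last 2 first.
- by move=> y _; rewrite adde_ge0 ?lee_fin ?clip_coord_ge0.
- exact: emeasurable_funD.
rewrite ge0_integralD//; last 2 first.
- by move=> y _; rewrite lee_fin clip_coord_ge0.
- by move=> y _; rewrite lee_fin clip_coord_ge0.
by rewrite !clipped_momentE.
Qed.

Lemma measurable_generator_clip N k : 0 <= N ->
  measurable_fun setT (exchange_generator p (clip_coord N k)).
Proof.
move=> N0; apply: (measurable_generator (M := N) (measurable_clip_coord N k)).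
  by move=> y; rewrite clip_coord_ge0 ?clip_coord_le.
by move=> e e0; exact: hL (bounded_local_clip_coord k N0) e e0.
Qed.

Lemma generator_clip_le N k y : 0 <= N ->
  `|exchange_generator p (clip_coord N k) y| <= 4 * N.
Proof.
move=> N0; have /andP[lo up] := exchange_generator_bounds hp k y N0.
have N20 : 0 <= N / 2 by rewrite divr_ge0.
have {}lo : 0 <= exchange_generator p (clip_coord N k) y + 2 * clip_coord N k y.
  rewrite -lee_fin; apply: le_trans lo; apply: lazy_op_ge0 => // l.
  by rewrite lee_fin clip_coord_ge0.
have {}up : exchange_generator p (clip_coord N k) y + 2 * clip_coord N k y <= 4 * N.
  rewrite -lee_fin; apply: (le_trans up).
  (* The constant [4 * N] is [lazy_op] of the constant [2 * N]. *)
  apply: (@le_trans _ _ (lazy_op p (fun=> (2 * N)%:E) k)).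
    by apply: le_lazy_op => // l; rewrite lee_fin clip_coord_le.
  by rewrite lazy_op_cst ?mulr_ge0// lee_fin; lra.
have := clip_coord_ge0 k y N0; have := clip_coord_le N k y.
by rewrite ler_norml => *; apply/andP; split; lra.
Qed.

Definition clipped_moment_deriv (N s : R) (k : S) : R :=
  semigroup P s (exchange_generator p (clip_coord N k)) x.

Lemma clipped_moment_unif_deriv N k (e : R) : 0 <= N -> 0 < e ->
  \forall h \near 0^'+, forall s : R, 0 <= s ->
  `|(clipped_moment N (s + h) k - clipped_moment N s k) / h -
    clipped_moment_deriv N s k| <= e.
Proof.
move=> N0; apply: (semigroup_unif_deriv hP (M := N) (M' := 4 * N)).
- exact: measurable_clip_coord.
- by move=> y; rewrite clip_coord_ge0 ?clip_coord_le.
- exact: measurable_generator_clip.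
- by move=> y; exact: generator_clip_le.
- by move=> r r0; exact: hL (bounded_local_clip_coord k N0) r r0.
Qed.

Lemma clipped_moment_deriv_bounds N s k : 0 <= N ->
  (lazy_op p (fun l => (clipped_moment (N / 2) s l)%:E) k <=
    (clipped_moment_deriv N s k + 2 * clipped_moment N s k)%:E <=
  lazy_op p (fun l => (clipped_moment (2 * N) s l)%:E) k)%E.
Proof.
move=> N0; set L := exchange_generator p (clip_coord N k).
have N20 : 0 <= N / 2 by rewrite divr_ge0.
have tN0 : 0 <= 2 * N by rewrite mulr_ge0.
have mL : measurable_fun setT L by exact: measurable_generator_clip.
have mf := measurable_clip_coord N k.
have m2f : measurable_fun setT (fun y : config R S => 2 * clip_coord N k y).
  by apply: measurable_funM => //; exact: measurable_cst.
have mE : measurable_fun setT (fun y => (L y + 2 * clip_coord N k y)%:E).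
  by apply/measurable_EFinP; exact: measurable_funD.
have iL := bounded_integrable P s x mL (fun y => generator_clip_le k y N0).
have if1 := bounded_integrable P s x mf (fun y => clip_norm k y N0).
have if2 : (P s x).-integrable setT (EFin \o (fun y => 2 * clip_coord N k y)).
  apply: (@bounded_integrable _ _ _ P s x _ (2 * N)) => // y.
  by rewrite normrM (ger0_norm (ler0n _ 2)) ler_pM2l// clip_norm.
have -> : (clipped_moment_deriv N s k + 2 * clipped_moment N s k)%:E =
    (\int[P s x]_y (L y + 2 * clip_coord N k y)%:E)%E.
  rewrite -(@semigroupE _ _ _ P s x (fun y => L y + 2 * clip_coord N k y) (4 * N + 2 * N)).
  - congr (_%:E); rewrite /clipped_moment_deriv /clipped_moment /semigroup.
    by rewrite RintegralD// RintegralZl.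
  - exact: measurable_funD.
  - move=> y; rewrite (le_trans (ler_normD _ _))// lerD ?generator_clip_le//.
    by rewrite normrM (ger0_norm (ler0n _ 2)) ler_pM2l// clip_norm.
have mJ M : 0 <= M -> measurable_fun setT
    (fun y : config R S => lazy_op p (fun l => (clip_coord M l y)%:E) k).
  by move=> M0; apply: measurable_esum => // j y; exact: term_ge0.
have J0 M y : 0 <= M -> (0 <= lazy_op p (fun l => (clip_coord M l y)%:E) k)%E.
  by move=> M0; apply: lazy_op_ge0 => // l; rewrite lee_fin clip_coord_ge0.
have bounds y := exchange_generator_bounds hp k y N0.
rewrite !lazy_op_clipped_moment//; apply/andP; split; apply: ge0_le_integral => //.
- by move=> y _; exact: J0.
- exact: mJ.
- by move=> y _; have /andP[] := bounds y.
- move=> y _; have /andP[+ _] := bounds y; apply: le_trans; exact: J0.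
- exact: mJ.
- by move=> y _; have /andP[] := bounds y.
Qed.

Lemma clipped_moment0 N k : 0 <= N -> clipped_moment N 0 k = clip_coord N k x.
Proof.
move=> N0; apply: semigroup0 => //; first exact: measurable_clip_coord.
by move=> y; exact: clip_coord_ge0.
Qed.

Section dyadic_levels.
Variable C : R.
Hypothesis C0 : 0 <= C.

(** Doubling the clipping level becomes the index shift that the comparison lemmas expect. *)
Let lev (m : nat) := 2 ^+ m * C.
Let lev0 m : 0 <= lev m. Proof. by rewrite mulr_ge0 ?exprn_ge0. Qed.
Let f m := clipped_moment (lev m).
Let df m := clipped_moment_deriv (lev m).

Let f0 m (s : R) i : 0 <= s -> 0 <= f m s i.
Proof. by move=> _; exact: clipped_moment_ge0. Qed.

Let f_deriv m i (e : R) : 0 < e -> \forall h \near 0^'+, forall s : R, 0 <= s ->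
  `|(f m (s + h) i - f m s i) / h - df m s i| <= e.
Proof. exact: clipped_moment_unif_deriv. Qed.

Let df_le m i (s : R) : 0 <= s -> `|df m s i| <= 4 * lev m.
Proof.
move=> _; apply: le_normr_semigroup; first exact: measurable_generator_clip.
by move=> y; exact: generator_clip_le.
Qed.

Let fu m i := unif_deriv_continuous (f_deriv m i) (df_le m i).
Let fd m i := unif_deriv_cvg (f_deriv m i).

Variable a : S -> \bar R.
Hypothesis a0 : forall i, (0 <= a i)%E.

(** As [a <= C], clipping [x] at any level [2 ^+ m * C] leaves it above [a] at time 0. *)
Lemma lazy_exp_sum_le_moment k t i : 0 <= t ->
  (forall j, (a j <= C%:E)%E) -> (forall j, (a j <= (x j)%:E)%E) ->
  (lazy_exp_sum p a k t i <= (expR (2 * t) * f k t i)%:E)%E.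
Proof.
move=> t0 aC ax.
apply: (@lazy_exp_sum_le R S p p0 p1 f df f0 fu fd a a0 C) => //.
- move=> m j; rewrite /f clipped_moment0// EFin_min le_min ax/=.
  by rewrite (le_trans (aC j))// lee_fin ler_peMl// exprn_ege1// ler1n.
- move=> m s j s0.
  have /andP[+ _] := @clipped_moment_deriv_bounds (lev m.+1) s j (lev0 m.+1).
  by rewrite (_ : lev m.+1 / 2 = lev m)// /lev exprS; field.
Qed.

Lemma moment_le_lazy_exp_series m t i : 0 <= t -> (forall j, ((x j)%:E <= a j)%E) ->
  ((expR (2 * t) * f m t i)%:E <=
    \sum_(n <oo) ((t ^+ n / n`!%:R)%:E * iter n (lazy_op p) a i))%E.
Proof.
move=> t0 xa.
apply: (@lazy_exp_series_ge R S p p0 p1 f df f0 fu fd a a0 C) => //.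
- move=> l s j s0; rewrite (le_trans (ler_norm _))//; apply: le_normr_semigroup.
    exact: measurable_clip_coord.
  by move=> y; exact: clip_norm.
- move=> l j; rewrite /f clipped_moment0//; apply: le_trans (xa j).
  by rewrite lee_fin ge_min lexx.
- move=> l s j s0.
  have /andP[_] := @clipped_moment_deriv_bounds (lev l) s j (lev0 l).
  by rewrite (_ : 2 * lev l = lev l.+1)// /lev exprS mulrA.
Qed.

End dyadic_levels.

Lemma clipped_moment_le N s k : 0 <= N ->
  ((clipped_moment N s k)%:E <= \int[P s x]_y (y k)%:E)%E.
Proof.
move=> N0; rewrite clipped_momentE//; apply: ge0_le_integral => //.
- by move=> y _; rewrite lee_fin clip_coord_ge0.
- by apply/measurable_EFinP; exact: measurable_coord.
- by move=> y _; rewrite lee_fin ge_min lexx.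
Qed.

(** Monotone convergence along the levels [2 ^+ m], where the clipped coordinate is eventually the
    coordinate itself. *)
Lemma integral_coord_le s k (M : \bar R) :
  (forall m, ((clipped_moment (2 ^+ m * 1) s k)%:E <= M)%E) ->
  (\int[P s x]_y (y k)%:E <= M)%E.
Proof.
move=> fM.
have h0 m : 0 <= 2 ^+ m * 1 :> R by rewrite mulr1 exprn_ge0.
have cvgk (y : config R S) : (clip_coord (2 ^+ m * 1) k y)%:E @[m --> \oo] --> (y k)%:E.
  apply: cvg_near_cst; near=> m; congr (_%:E); apply: min_l; rewrite mulr1.
  apply: (@le_trans _ _ m%:R); last first.
    by rewrite -natrX ler_nat ltnW// ltn_expl.
  near: m; exact: nbhs_infty_ger.
have ge0 m y : [set: config R S] y -> (0 <= (clip_coord (2 ^+ m * 1) k y)%:E)%E.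
  by move=> _; rewrite lee_fin clip_coord_ge0.
have nd y : [set: config R S] y -> {homo (fun m : nat =>
    (clip_coord (2 ^+ m * 1) k y)%:E) : m n / (m <= n)%N >-> (m <= n)%E}.
  move=> _ m n mn; rewrite lee_fin clip_coord_mono// !mulr1.
  by rewrite ler_weXn2l// ler1n.
have cv := @cvg_monotone_convergence _ _ _ (P s x) setT measurableT
  (fun m y => (clip_coord (2 ^+ m * 1) k y)%:E) (fun m => mclip _ _) ge0 nd.
rewrite (eq_integral (fun y => limn (fun m => (clip_coord (2 ^+ m * 1) k y)%:E))); last first.
  by move=> y _; apply/esym/cvg_lim => //; exact: cvgk.
rewrite -(cvg_lim _ cv)//; apply: lime_le; first exact: cvgP cv.
by near=> m; rewrite -clipped_momentE.
Unshelve. all: by end_near. Qed.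

Lemma integral_coord (q : R -> S -> S -> R) t i : walk_transition p q -> 0 <= t ->
  (\int[P t x]_y (y i)%:E = \esum_(j in [set: S]) (q t i j * x j)%:E)%E.
Proof.
move=> hq t0.
have x0 := coord_ge0 x.
have eF : (0 < (expR (2 * t))%:E :> \bar R)%E by rewrite lte_fin expR_gt0.
apply/eqP; rewrite eq_le; apply/andP; split.
  apply: integral_coord_le => m.
  have := @moment_le_lazy_exp_series 1 ler01 (fun j => (x j)%:E) x0 m t i t0 (fun j => lexx _).
  by rewrite (walk_series_sum p0 p1 x0 i hq t0) EFinM lee_pmul2l// lte_fin expR_gt0.
apply: ge_ereal_sup => _ [A [finA _] <-].
have [K AK] := (finite_seqP A).1 finA.
(* The lower bound needs a bounded initial condition, and [x] may be unbounded. It is cut to the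
   finite set [K], where its sum [C] bounds it; the supremum over finite sets then recovers the full
   sum. *)
pose xK j := if j \in K then x j else 0.
have xK0 j : 0 <= xK j by rewrite /xK; case: ifP.
pose C := \sum_(j <- K) x j.
have C0 : 0 <= C by rewrite sumr_ge0.
have xKC j : xK j <= C.
  rewrite /xK; case: ifP => // jK; rewrite /C (big_rem j)//= lerDl sumr_ge0//.
have xKx j : xK j <= x j by rewrite /xK; case: ifP.
apply: (@le_trans _ _ (\esum_(j in [set: S]) (q t i j * xK j)%:E)%E).
  apply: esum_ge; exists A => //; rewrite le_eqVlt; apply/orP; left; apply/eqP.
  apply: eq_fsbigr => j; rewrite AK => /set_mem/= jK.
  by rewrite /xK jK.
rewrite -(@lee_pmul2l _ (expR (2 * t))%:E)//.
rewrite -(walk_series_sum p0 p1 xK0 i hq t0).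
apply: lazy_exp_series_le => // k.
have := @lazy_exp_sum_le_moment C C0 (fun j => (xK j)%:E) xK0 k t i t0 xKC xKx.
move=> /le_trans; apply; rewrite EFinM lee_pmul2l//.
by apply: clipped_moment_le; rewrite mulr_ge0 ?exprn_ge0.
Qed.

End clipped_moments.

(** * From the transition kernel to the process *)

Unset Implicit Arguments.

Theorem proposition3p2 (R : realType) (S : countType) (p : S -> S -> R)
    (hp : irreducible_symmetric_kernel p)
    (q : R -> S -> S -> R) (hq : walk_transition p q)
    (P : R -> R.-pker (config R S) ~> (config R S))
    (hP : transition_semigroup P)
    (hL : has_generator_on P (bounded_local (S:=S)) (exchange_generator p))
    (x : config R S)
    (d : measure_display) (W : measurableType d) (Pr : probability W R)
    (X : R -> W -> config R S) (hX : markov_process_from Pr P x X)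
    (i : S) (t : R) (ht : 0 < t) :
  ('E_Pr[fun w => X t w i] = \esum_(j in [set: S]) (q t i j * x j)%:E)%E.
Proof.
have t0 := ltW ht.
have mX := process_measurable hX t0.
rewrite -(integral_coord hp hP hL x i hq t0) unlock.
have m0 : {in [set: config R S], forall y : config R S, (0 <= (y i)%:E)%E}.
  by move=> y _; rewrite lee_fin coord_ge0.
have mi : measurable_fun [set: config R S] (fun y => (y i)%:E).
  by apply/measurable_EFinP; exact: measurable_coord.
rewrite -[LHS](ge0_integral_pushforward mX Pr measurableT mi m0).
apply: eq_measure_integral => A mA _.
have pT : past X 0 [set: W].
  by move=> Z [[Z0 ZC _] _]; rewrite -(setD0 setT); exact: ZC.
(* The Markov property at time 0 on the sure event gives the law of [X t] as the mean of
   [P t (X 0 w)], and [X 0 = x] almost surely. *)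
have := process_markov hX (lexx 0) t0 pT mA.
rewrite add0r setTI => PX.
rewrite [LHS]PX (ae_eq_integral (fun=> P t x A))//.
- by rewrite (integral_cst _ measurableT) [X in (_ * X)%E]probability_setT mule1.
- have mK := measurable_kernel (P t) A mA.
  exact: measurableT_comp mK (process_measurable hX (lexx 0)).
- by apply: filterS (process_start hX) => w -> _.
Qed.
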